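(* For every real $d \ge 1$ there exists a constant $\varepsilon_d > 0$, depending only on $d$, such that the following holds. There is an algorithm which, given an $n$-vertex undirected graph $G=(V,E)$ of average degree at most $d$ together with an edge weight function $c : E \to \mathbb{R}_+$, finds a Hamiltonian cycle of $G$ of smallest total weight (or reports that $G$ has no Hamiltonian cycle) in $\mathcal{O}^\star(2^{(1-\varepsilon_d)n})$ time and exponential space.
   Context: Graphs are finite. The average degree of an $n$-vertex graph $G=(V,E)$ is $\frac1n\sum_{v\in V}\deg(v) = 2|E|/n$. The weight of a cycle is the sum of the weights $c(e)$ of its edges. The notation $\mathcal{O}^\star(\cdot)$ suppresses factors polynomial in the input size; arithmetic operations and comparisons on weights are performed in the usual way (e.g. at unit or polynomial cost). ''Exponential space'' means that the space used is not restricted to be polynomial. *)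

(* Defs.v *)
From HB Require Import structures.
From mathcomp Require Import all_boot all_order all_algebra.
From mathcomp Require Import all_classical all_reals all_analysis.

Set Implicit Arguments.
Unset Strict Implicit.
Unset Printing Implicit Defensive.

Import Order.TTheory GRing.Theory Num.Theory.

Local Open Scope ring_scope.

Record sgraph (n : nat) := SGraph {
  adj : rel 'I_n;
  adj_sym : symmetric adj;
  adj_irr : irreflexive adj
}.

Definition edges (n : nat) (G : sgraph n) : {set {set 'I_n}} :=
  [set [set x; y] | x in 'I_n, y in 'I_n & adj G x y].

Definition deg (n : nat) (G : sgraph n) (v : 'I_n) : nat :=
  #|[set u | adj G v u]|.

Definition avg_degree (R : realType) (n : nat) (G : sgraph n) : R :=
  (\sum_(v : 'I_n) deg G v)%N%:R / n%:R.

(* A cycle is listed as the sequence of its vertices in cyclic order.  Cycles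
   of a simple graph have at least three vertices, whereas [cycle] alone also
   accepts the empty sequence and an edge traversed back and forth. *)
Definition ham_cycle (n : nat) (G : sgraph n) (h : seq 'I_n) : bool :=
  [&& (2 < n)%N, size h == n & ucycleb (adj G) h].

Definition cycle_weight (R : realType) (n : nat) (c : {set 'I_n} -> R)
    (h : seq 'I_n) : R :=
  \sum_(x <- h) c [set x; next h x].

(* Algorithms are programs of a structured random access machine.  A state has
   countably many unbounded arrays of natural numbers and countably many
   unbounded arrays of reals; a program names finitely many of them, and a
   scalar variable is a cell with constant index.  Operations on natural
   numbers, including indexing, are charged the bit length of their operands
   (logarithmic cost), so that long integers give no free parallelism.  Reals
   can only be copied, added, subtracted and compared, at unit cost; programs
   contain no real constant besides 0, and reals cannot be turned into natural
   numbers other than through comparisons. *)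

Inductive binop := Add | Sub | Mul | Div | Mod.

Inductive nexpr :=
| NCst of nat
| NGet of nat & nexpr   (* array name, index *)
| NBop of binop & nexpr & nexpr.

Inductive rexpr :=
| RZero
| RGet of nat & nexpr
| RAdd of rexpr & rexpr
| RSub of rexpr & rexpr.

Inductive bexpr :=
| NLe of nexpr & nexpr
| NEq of nexpr & nexpr
| RLe of rexpr & rexpr
| BNot of bexpr
| BAnd of bexpr & bexpr.

Inductive cmd :=
| Skip
| NSet of nat & nexpr & nexpr   (* array name, index, value *)
| RSet of nat & nexpr & rexpr
| Seq of cmd & cmd
| If of bexpr & cmd & cmd
| While of bexpr & cmd.

Record state (R : realType) := State {
  nmem : nat -> nat -> nat;
  rmem : nat -> nat -> R
}.

Definition upd (T : Type) (m : nat -> nat -> T) (a i : nat) (v : T) :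
    nat -> nat -> T :=
  fun b j => if (b == a) && (j == i) then v else m b j.

Definition bitlen (m : nat) : nat := (trunc_log 2 m).+1.

Definition bop_eval (o : binop) (x y : nat) : nat :=
  match o with
  | Add => (x + y)%N
  | Sub => (x - y)%N
  | Mul => (x * y)%N
  | Div => (x %/ y)%N
  | Mod => (x %% y)%N
  end.

Fixpoint neval (R : realType) (s : state R) (e : nexpr) : nat :=
  match e with
  | NCst k => k
  | NGet a i => nmem s a (neval s i)
  | NBop o e1 e2 => bop_eval o (neval s e1) (neval s e2)
  end.

Fixpoint ncost (R : realType) (s : state R) (e : nexpr) : nat :=
  match e with
  | NCst k => bitlen k
  | NGet a i => (ncost s i + bitlen (neval s i) + bitlen (neval s e))%N
  | NBop o e1 e2 => (ncost s e1 + ncost s e2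
                     + bitlen (neval s e1) + bitlen (neval s e2))%N
  end.

Fixpoint reval (R : realType) (s : state R) (e : rexpr) : R :=
  match e with
  | RZero => 0
  | RGet a i => rmem s a (neval s i)
  | RAdd e1 e2 => reval s e1 + reval s e2
  | RSub e1 e2 => reval s e1 - reval s e2
  end.

Fixpoint rcost (R : realType) (s : state R) (e : rexpr) : nat :=
  match e with
  | RZero => 1%N
  | RGet a i => (ncost s i + bitlen (neval s i) + 1)%N
  | RAdd e1 e2 | RSub e1 e2 => (rcost s e1 + rcost s e2 + 1)%N
  end.

Fixpoint beval (R : realType) (s : state R) (b : bexpr) : bool :=
  match b with
  | NLe e1 e2 => (neval s e1 <= neval s e2)%N
  | NEq e1 e2 => neval s e1 == neval s e2
  | RLe e1 e2 => reval s e1 <= reval s e2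
  | BNot b1 => ~~ beval s b1
  | BAnd b1 b2 => beval s b1 && beval s b2
  end.

Fixpoint bcost (R : realType) (s : state R) (b : bexpr) : nat :=
  match b with
  | NLe e1 e2 | NEq e1 e2 => (ncost s e1 + ncost s e2
                              + bitlen (neval s e1) + bitlen (neval s e2))%N
  | RLe e1 e2 => (rcost s e1 + rcost s e2 + 1)%N
  | BNot b1 => (bcost s b1 + 1)%N
  | BAnd b1 b2 => (bcost s b1 + bcost s b2 + 1)%N
  end.

(* [exec p s s' t]: started in [s], [p] halts in [s'] after time [t]. *)
Inductive exec (R : realType) : cmd -> state R -> state R -> nat -> Prop :=
| exec_skip s : exec Skip s s 1%N
| exec_nset a i e s :
    exec (NSet a i e) s
      (State (upd (nmem s) a (neval s i) (neval s e)) (rmem s))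
      (ncost s i + ncost s e + bitlen (neval s i) + bitlen (neval s e))%N
| exec_rset a i e s :
    exec (RSet a i e) s
      (State (nmem s) (upd (rmem s) a (neval s i) (reval s e)))
      (ncost s i + rcost s e + bitlen (neval s i) + 1)%N
| exec_seq p q s s' s'' t t' :
    exec p s s' t -> exec q s' s'' t' -> exec (Seq p q) s s'' (t + t')%N
| exec_if_true b p q s s' t :
    beval s b -> exec p s s' t -> exec (If b p q) s s' (bcost s b + t)%N
| exec_if_false b p q s s' t :
    ~~ beval s b -> exec q s s' t -> exec (If b p q) s s' (bcost s b + t)%N
| exec_while_true b p s s' s'' t t' :
    beval s b -> exec p s s' t -> exec (While b p) s' s'' t' ->
    exec (While b p) s s'' (bcost s b + t + t')%N
| exec_while_false b p s :
    ~~ beval s b -> exec (While b p) s s (bcost s b).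

(* Entry (i, j) of an n x n table is stored at index i * n + j. *)
Definition table (T : Type) (x0 : T) (n : nat) (f : 'I_n -> 'I_n -> T)
    (k : nat) : T :=
  match insub (k %/ n)%N, insub (k %% n)%N with
  | Some i, Some j => f i j
  | _, _ => x0
  end.

(* Natural array 0 holds n at index 0, natural array 1 the adjacency matrix and
   real array 0 the matrix of edge weights; every other cell is 0.  Values of
   [c] outside the edge set are hidden from the program. *)
Definition input (R : realType) (n : nat) (G : sgraph n)
    (c : {set 'I_n} -> R) : state R :=
  State
    (fun a k => match a with
                | 0%N => if k == 0%N then n else 0%N
                | 1%N => table 0%N (fun i j => nat_of_bool (adj G i j)) k
                | _ => 0%N
                end)
    (fun a k => match a with
                | 0%N => table 0 (fun i j => if adj G i j then c [set i; j]
                                             else 0) k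
                | _ => 0
                end).

(* Natural array 2 holds, at index 0, zero iff no cycle is reported; the n
   vertices of a reported cycle are the first n entries of natural array 3. *)
Definition output (R : realType) (n : nat) (s : state R) : option (seq nat) :=
  if nmem s 2%N 0%N == 0%N then None else Some (mkseq (nmem s 3%N) n).

Definition tsp_answer (R : realType) (n : nat) (G : sgraph n)
    (c : {set 'I_n} -> R) (o : option (seq nat)) : Prop :=
  match o with
  | None => forall h : seq 'I_n, ~~ ham_cycle G h
  | Some s => exists h : seq 'I_n,
      [/\ s = [seq val x | x <- h], ham_cycle G h &
          forall h' : seq 'I_n, ham_cycle G h' ->
            cycle_weight c h <= cycle_weight c h']
  end.

(* Main.v *)
(* Run the Held-Karp dynamic program breadth first, only on the states (X, v)
   such that some path from a fixed vertex z visits exactly X and ends in v; its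
   cost is the number of such states up to polynomial factors, so the point is
   that only 2^((1-eps)n) sets X are reachable.  Let H be the set of vertices of
   degree at least D.  An averaging argument over dyadic D, bounded in terms of
   d, makes H as small as we like compared with n / D, whereas greedily one
   finds a family A of order n / D of vertices of degree at most 2d outside H
   whose closed neighbourhoods are pairwise disjoint outside H.  Call v in A
   lonely in X if v is the only vertex of X in its closed neighbourhood outside
   H.  On a path visiting X a lonely vertex other than z is preceded by a vertex
   of H, so at most |H| + 1 vertices of A are lonely; but the blocks being
   disjoint, the sets X with so few lonely vertices are exponentially rare. *)

Require Import Defs.
From HB Require Import structures.
From mathcomp Require Import all_boot all_order all_algebra.
From mathcomp Require Import all_classical all_reals all_analysis.
From mathcomp Require Import zify lra ring.

Set Implicit Arguments.
Unset Strict Implicit.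
Unset Printing Implicit Defensive.

Import Order.TTheory GRing.Theory Num.Theory.

Local Open Scope ring_scope.

(** * Counting reachable sets *)

(** Two effects compete: allowing few lonely vertices gains a factor [(1 - 1/q) ^ |A|], with [q]
    depending on [d] only, while tolerating [|H| + 1] of them costs [2 ^ (|H| + 1)]. So [H] must be
    small compared with [A], by a constant fixed in advance. No single degree threshold guarantees
    this, since a degree sequence of given average may concentrate its mass at any one scale; hence
    the search over several scales. Deleting [H] from the blocks is forced as well: low-degree
    vertices may all share one neighbour of huge degree, and then no two of their closed
    neighbourhoods are disjoint. The rare sets are counted by an exponential moment instead of
    binomial tails, because a product over disjoint blocks can be summed block by block. The outcome
    is kept in the integer form [F ^ W * 2 ^ n <= 2 ^ (W * n.+1)], so that no logarithm occurs and
    the saving in the exponent is simply [1 / W]. *)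

Definition lonely (T : finType) (S : T -> {set T}) (v : T) (X : {set T}) :=
  X :&: S v == [set v].

(** Replacing the trace on [S v] by the singleton of [v] makes [v] lonely and leaves [F] unchanged.
    Sets merged by this map differ only in their trace on [S v], so at most [2 ^ t] of them are
    merged. *)
Lemma lonely_fibre (T : finType) (S : T -> {set T}) (v : T) (t : nat)
    (F : {set T} -> nat) :
  v \in S v -> (#|S v| <= t)%N ->
  (forall X, F (v |: (X :\: S v)) = F X) ->
  (\sum_(X : {set T}) F X <= 2 ^ t * \sum_(X | lonely S v X) F X)%N.
Proof.
move=> vS St Fphi; pose phi (X : {set T}) := v |: (X :\: S v).
have phiL X : lonely S v (phi X).
  rewrite /lonely /phi; apply/eqP/setP => x; rewrite !inE.
  by have [->|] := eqVneq x v; rewrite ?vS //=; case: (x \in S v); rewrite ?andbF.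
rewrite (partition_big phi (lonely S v)) //= big_distrr /=.
apply: leq_sum => Y lY.
rewrite (eq_bigr (fun _ => F Y)); last by move=> X /eqP <-; rewrite Fphi.
rewrite sum_nat_const leq_mul2r; apply/orP; right.
apply: leq_trans (_ : #|powerset (S v)| <= _)%N; last first.
  by rewrite card_powerset leq_exp2l.
have -> : #|[pred X | phi X == Y]| = #|[set X : {set T} | phi X == Y]|.
  by apply: eq_card => X; rewrite !inE.
rewrite -(@card_in_imset _ _ (fun X => X :&: S v)) => [|X X'].
  apply: subset_leq_card; apply/fintype.subsetP => _ /imsetP [X _ ->].
  by rewrite inE subsetIr.
rewrite !inE => /eqP XY /eqP X'Y XX'; apply/setP => x.
have [xS|xS] := boolP (x \in S v).
  by move/setP/(_ x): XX'; rewrite !inE xS !andbT.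
have xv : (x == v) = false by apply: contraNF xS => /eqP ->.
by move/setP/(_ x): (etrans XY (esym X'Y)); rewrite !inE xv (negbTE xS).
Qed.

(* Weighting each set by 2 to the number of its non-lonely vertices makes the
   sum over all sets factor over the disjoint blocks. *)
Lemma lonely_weight (T : finType) (S : T -> {set T}) (t : nat) (A : seq T) :
  uniq A -> {in A, forall v, v \in S v /\ (#|S v| <= t)%N} ->
  {in A &, forall u v, u != v -> [disjoint S u & S v]} ->
  ((2 ^ t.+1) ^ size A *
     \sum_(X : {set T}) \prod_(v <- A) (if lonely S v X then 1 else 2)
   <= 2 ^ size A * (2 ^ t.+1).-1 ^ size A * 2 ^ #|T|)%N.
Proof.
elim: A => [|v A IH] /=.
  move=> _ _ _; rewrite !expn0 !mul1n (eq_bigr (fun=> 1%N)) => [|X _].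
    by rewrite sum1_card (eq_card (B := powerset [set: T])) ?card_powerset
      ?cardsT // => X; rewrite !inE finset.subsetT.
  by rewrite big_nil.
move=> /andP [vA uA] HS HD.
have sA x : x \in A -> x \in v :: A by rewrite inE orbC => ->.
have {IH}IH := IH uA (fun x xA => HS x (sA x xA))
  (fun x y xA yA => HD x y (sA x xA) (sA y yA)).
have [vS St] := HS v (mem_head _ _).
set F := fun X : {set T} => (\prod_(u <- A) (if lonely S u X then 1 else 2))%N.
have Fphi X : F (v |: (X :\: S v)) = F X.
  apply: eq_big_seq => u uA'; rewrite /lonely.
  suff -> : (v |: (X :\: S v)) :&: S u = X :&: S u by [].
  have uv : u != v by apply: contraNneq vA => <-.
  have /pred0P dis := HD u v (sA u uA') (mem_head _ _) uv.
  apply/setP => x; rewrite !inE; move: (dis x) => /=.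
  case xu: (x \in S u); rewrite ?andbF //= !andbT => xv; rewrite xv /=.
  by case: eqP xv => // ->; rewrite vS.
have fib := lonely_fibre vS St Fphi.
set L := (\sum_(X | lonely S v X) F X)%N in fib.
set W := (\sum_X F X)%N in fib IH.
have -> : (\sum_(X : {set T}) \prod_(u <- v :: A)
    (if lonely S u X then 1 else 2) = 2 * W - L)%N.
  rewrite (eq_bigr (fun X => (if lonely S v X then 1 else 2) * F X)%N);
    last by move=> X _; rewrite big_cons.
  rewrite /W (bigID (lonely S v)) /= [X in (2 * X)%N](bigID (lonely S v)) /=.
  rewrite -/L (eq_bigr F); last by move=> X ->; rewrite mul1n.
  rewrite [X in (_ + X = _)%N](eq_bigr (fun X => 2 * F X)%N); last first.
    by move=> X /negbTE ->.
  rewrite -big_distrr /= -/L; lia.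
(* Weight 2 on every set would give [2 * W]; the lonely sets save [L], and [fib] makes [L] at least
   [W / 2 ^ t]. This is the loss of one unit out of [2 ^ t.+1]. *)
have stepW : (2 ^ t.+1 * (2 * W - L) <= 2 * (2 ^ t.+1).-1 * W)%N.
  rewrite expnS; have := expn_gt0 2 t; move: (2 ^ t)%N fib => p; nia.
have [->|W0] := posnP W; first by rewrite muln0 sub0n muln0.
rewrite !(expnS _ (size A)).
set a := (_ ^ size A)%N in IH *; set b := (2 ^ size A)%N in IH *.
set e := (_.-1 ^ size A)%N in IH *.
have := leq_mul stepW IH.
move: (2 ^ t.+1)%N (2 ^ #|T|)%N (2 * W - L)%N => Q N Z.
rewrite (_ : Q * Z * (a * W) = (Q * a * Z) * W)%N; last by lia.
rewrite (_ : 2 * Q.-1 * W * (b * e * N) = (2 * b * (Q.-1 * e) * N) * W)%N; last by lia.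
by rewrite leq_pmul2r.
Qed.

(** A geometric sum is below twice its largest term, and here that term is at most [m]. *)
Lemma sum_pow2_le (m J : nat) :
  (\sum_(j < J | 2 ^ j <= m) 2 ^ j <= 2 * m)%N.
Proof.
have geom k : (\sum_(j < k) 2 ^ j < 2 ^ k)%N.
  elim: k => [|k IH]; first by rewrite big_ord0.
  by rewrite big_ord_recr /= expnS mul2n -addnn -addSn leq_add2r.
elim: J => [|J IH]; first by rewrite big_ord0.
have [mJ|mJ] := leqP (2 ^ J) m; last first.
  by rewrite big_mkcond big_ord_recr /= [(2 ^ J <= m)%N]leqNgt mJ addn0 -big_mkcond.
apply: leq_trans (_ : \sum_(j < J.+1) 2 ^ j <= _)%N.
  by rewrite big_mkcond; apply: leq_sum => j _; case: ifP.
apply: ltnW (leq_trans (geom J.+1) _).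
by rewrite expnS leq_mul2l mJ orbT.
Qed.

(* Among boundedly many dyadic thresholds D one leaves only #|T| / (M D)
   vertices of degree at least D: otherwise the degree sum is too large. *)
Lemma dyadic_threshold (T : finType) (f : T -> nat) (d M : nat) :
  (0 < #|T|)%N -> (\sum_v f v <= d * #|T|)%N ->
  exists2 j, (j <= 2 * d * M)%N &
    (M * (2 ^ j * #|[set v | (2 ^ j <= f v)%N]|) <= #|T|)%N.
Proof.
move=> T0 fd; pose J := (2 * d * M).+1.
apply: contrapT => nex.
have big (j : 'I_J) :
    (#|T| < M * (2 ^ j * #|[set v | (2 ^ j <= f v)%N]|))%N.
  rewrite ltnNge; apply/negP => h; apply: nex; exists j => //.
  by rewrite -ltnS.
have : (J * #|T| < M * (\sum_(j < J) 2 ^ j * #|[set v | 2 ^ j <= f v]|) + 1)%N.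
  rewrite addn1 ltnS -[J in (J * _ <= _)%N]card_ord -sum_nat_const big_distrr.
  apply: leq_sum => j _ /=.
  exact: ltnW.
(* Double counting: [v] is charged [2 ^ j] at each threshold that [f v] reaches, at most [2 * f v]
   in all. The resulting budget [2 * d * M * #|T|] cannot serve [J] thresholds, one more than
   [2 * d * M]. *)
have -> : (\sum_(j < J) 2 ^ j * #|[set v | 2 ^ j <= f v]|
         = \sum_v \sum_(j < J | 2 ^ j <= f v) 2 ^ j)%N.
  rewrite (exchange_big_dep xpredT) //=; apply: eq_bigr => j _.
  rewrite sum_nat_const mulnC; congr muln.
  by apply: eq_card => v; rewrite !inE.
have : (\sum_v \sum_(j < J | 2 ^ j <= f v) 2 ^ j <= 2 * (d * #|T|))%N.
  apply: leq_trans (_ : \sum_v 2 * f v <= _)%N.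
    by apply: leq_sum => v _; apply: sum_pow2_le.
  by rewrite -big_distrr leq_mul2l.
move: (\sum_v _)%N => s hs; rewrite addn1 ltnS => h.
have := leq_trans h (leq_mul (leqnn M) hs).
rewrite /J mulSn; lia.
Qed.

(** Each chosen vertex discards its [r]-neighbours, at most [K] vertices including itself by
    reflexivity, so the supply lasts for at least [#|U| / K] choices. *)
Lemma greedy_independent (T : finType) (r : rel T) (K : nat) (U : {set T}) :
  reflexive r -> symmetric r ->
  {in U, forall v, (#|[set u | r v u]| <= K)%N} ->
  exists A : seq T, [/\ uniq A, {subset A <= U},
    {in A &, forall u v, u != v -> ~~ r u v} & (#|U| <= size A * K)%N].
Proof.
move=> rr sr; have [k] := ubnP #|U|; elim: k U => // k IH U Uk rK.
have [->|[v vU]] := set_0Vmem U; first by exists [::]; rewrite cards0.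
pose W := [set u | r v u].
have UW : (#|U :\: W| < k)%N.
  apply: leq_trans (_ : #|U| <= k)%N; last by [].
  apply: proper_card; apply/properP; split; first exact: subsetDl.
  by exists v => //; rewrite !inE rr.
have [|A [uA AU indA cA]] := IH _ UW.
  by move=> u; rewrite inE => /andP [_ /rK].
exists (v :: A); split => /=.
- rewrite uA andbT; apply/negP => /AU; by rewrite !inE rr.
- move=> u; rewrite inE => /orP [/eqP -> //|/AU]; by rewrite inE => /andP [].
- move=> a b; rewrite !inE => /orP [/eqP ->|aA] /orP [/eqP ->|bA];
    rewrite ?eqxx //; last exact: indA.
    by move=> _; move/AU: bA; rewrite !inE => /andP [].
  by move=> _; move/AU: aA; rewrite !inE sr => /andP [].
- rewrite -(cardsID W U) mulSn leq_add //.
  apply: leq_trans (rK v vU); apply: subset_leq_card; exact: subsetIr.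
Qed.

Definition simple_path (n : nat) (G : sgraph n) (z : 'I_n) (p : seq 'I_n) :=
  path (adj G) z p && uniq (z :: p).

Definition nbhd (n : nat) (G : sgraph n) (H : {set 'I_n}) (v : 'I_n) :=
  (v |: [set u | adj G v u]) :\: H.

(* The vertex that precedes a lonely vertex on the path must lie in H. *)
Lemma count_lonely (n : nat) (G : sgraph n) (z : 'I_n) (p : seq 'I_n)
    (H : {set 'I_n}) (A : seq 'I_n) :
  simple_path G z p -> uniq A ->
  (count (fun v => lonely (nbhd G H) v [set x in z :: p]) A <= #|H|.+1)%N.
Proof.
move=> /andP [pp up] uA; set lon := fun v => _.
rewrite -size_filter.
pose B := [seq v <- A | lon v && (v != z)].
(* The start [z] has no predecessor and is set apart; it accounts for the successor in the bound. *)
apply: leq_trans (_ : (size (z :: B) <= _)%N).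
  apply: uniq_leq_size; first exact: filter_uniq.
  move=> v; rewrite mem_filter => /andP [lv vA].
  by rewrite inE /B mem_filter lv vA andbT; case: eqP.
rewrite ltnS.
pose f v := nth z (z :: p) (index v p).
have Bp v : v \in B -> [/\ lon v, v != z & v \in p].
  rewrite mem_filter => /andP [/andP [lv vz] _]; split => //.
  move/eqP/setP/(_ v): lv; rewrite !inE (negbTE vz) eqxx /= => /andP [] //.
suff : (size [seq f v | v <- B] <= #|H|)%N by rewrite size_map.
rewrite cardE; apply: uniq_leq_size.
  rewrite map_inj_in_uniq; first exact: filter_uniq.
  move=> u v /Bp [_ _ up'] /Bp [_ _ vp] /eqP.
  rewrite nth_uniq //= ?ltnS ?index_size // => /eqP uv.
  by rewrite -(nth_index z up') uv nth_index.
move=> _ /mapP [v /Bp [lv vz vp] ->]; rewrite mem_enum.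
have iv : (index v p < size p)%N by rewrite index_mem.
have adjv : adj G (f v) v.
  by move/(pathP z)/(_ _ iv): pp; rewrite nth_index.
have fX : f v \in z :: p by rewrite mem_nth //= ltnS ltnW.
have fv : f v != v by apply: contraTneq adjv => ->; rewrite adj_irr.
(* Outside [H] the predecessor would be a vertex of the path in the block of [v], and loneliness
   would identify it with [v]. *)
apply: contraNT fv => fH.
move: fX; rewrite inE => fX.
move/eqP/setP/(_ (f v)): lv.
by rewrite !inE fX fH [adj G v _]adj_sym adjv orbT => <-.
Qed.

Lemma card_bigcup_le (I T : finType) (P : pred I) (F : I -> {set T}) :
  (#|finset.cover [set F i | i in P]| <= \sum_(i in P) #|F i|)%N.
Proof.
rewrite cover_imset.
elim/big_rec2: _ => [|i m X _ IH]; first by rewrite cards0.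
by apply: leq_trans (leq_add (leqnn _) IH); rewrite -cardsUI leq_addr.
Qed.

(** Bernoulli's inequality without division: for positive [m] this is [(1 + 1/m) ^ (m+1) >= 2]. It
    converts powers of [1 - 1/q] into powers of 2. *)
Lemma double_pow_pred (m : nat) : (2 * m ^ m.+1 <= m.+1 ^ m.+1)%N.
Proof.
have bern k : (m ^ k.+1 + k.+1 * m ^ k <= m.+1 ^ k.+1)%N.
  elim: k => [|k IH]; first by rewrite !expn1 expn0; lia.
  rewrite (expnS m.+1) (expnS m k.+1).
  apply: leq_trans (leq_mul (leqnn m.+1) IH).
  by rewrite (expnS m k); move: (m ^ k)%N => x; nia.
apply: leq_trans (bern m); rewrite expnS; lia.
Qed.

(** Raised to the power [2 * q], the factor [(m / q) ^ a] drops to at most [2 ^ (- 2 * a)] by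
    [double_pow_pred]. Half of this gain pays for [2 ^ (2 * q * h)], because [2 * q * h <= a]; the
    other half is the [2 ^ a] of the conclusion. *)
Lemma reachable_powers (F a b h n m : nat) : let q := m.+1 in
  (0 < m)%N ->
  (F * q ^ a <= 2 ^ b * m ^ a * 2 ^ n)%N -> (b <= h.+1)%N ->
  (2 * q * h <= a)%N -> (F ^ (2 * q) * 2 ^ a <= 2 ^ (2 * q + 2 * n * q))%N.
Proof.
move=> q m0 hF hb ha.
have q0 : (0 < 2 * q)%N by lia.
move: hF; rewrite -(leq_exp2r _ _ q0) !expnMn -!expnM => hF.
have a0 : forall x y, (x <= y -> x ^ (2 * a) <= y ^ (2 * a))%N.
  move=> x y xy; have [->|a0] := posnP a; first by rewrite muln0 !expn0.
  by rewrite leq_exp2r //; lia.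
have := a0 _ _ (double_pow_pred m); rewrite expnMn -!expnM -/q => h2.
have := leq_mul hF h2.
have -> : (a * (2 * q) = q * (2 * a))%N by rewrite mulnCA mulnA mulnC; lia.
have : (0 < q ^ (q * (2 * a)) * m ^ (q * (2 * a)))%N.
  by rewrite muln_gt0 !expn_gt0 m0.
move: (q ^ (q * (2 * a)))%N (m ^ (q * (2 * a)))%N => X Y XY.
have acF (f p : nat) : (f * X * (p * Y) = f * p * (X * Y))%N by lia.
have acB (f p : nat) : (f * Y * p * X = f * p * (X * Y))%N by lia.
rewrite acF acB leq_pmul2r //.
rewrite (_ : 2 * a = a + a)%N ?(expnD _ a a) ?mulnA -?expnD => [h3|]; last by lia.
rewrite -(@leq_pmul2r (2 ^ a)) ?expn_gt0 //.
apply: leq_trans h3 _; rewrite -expnD leq_exp2l //; nia.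
Qed.

(** Markov's inequality for the degrees, at twice their average bound. *)
Lemma card_low_degree (n : nat) (G : sgraph n) (d : nat) :
  (\sum_v deg G v <= d * n)%N ->
  (n <= 2 * #|[set v | (deg G v <= 2 * d)%N]|)%N.
Proof.
move=> dn; set L := [set v | _].
have cLC : (#|L| + #|~: L| = n)%N by rewrite cardsC card_ord.
have : (#|~: L| * (2 * d).+1 <= d * n)%N.
  apply: leq_trans dn; rewrite -sum_nat_const.
  rewrite big_mkcond; apply: leq_sum => v _; rewrite !inE -ltnNge.
  by case: ifP.
nia.
Qed.

(** For the third bound: if the blocks of [u] and [v] share a vertex [x], then [u] is in the closed
    neighbourhood of [x]. There are at most [2 * d + 1] choices for [x], and each, being outside
    [H], has a closed neighbourhood of at most [2 ^ D] vertices. *)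
Lemma nbhd_props (n : nat) (G : sgraph n) (D d : nat) (v : 'I_n) :
  let H := [set v | (2 ^ D <= deg G v)%N] in
  v \notin H -> (deg G v <= 2 * d)%N ->
  [/\ v \in nbhd G H v, (#|nbhd G H v| <= (2 * d).+1)%N &
   (#|[set u | (u == v) || ~~ [disjoint nbhd G H u & nbhd G H v]]|
      <= (2 * d).+1 * 2 ^ D)%N].
Proof.
move=> H vH dv.
have cN x : (#|x |: [set u | adj G x u]| <= (deg G x).+1)%N.
  by rewrite cardsU1 /deg; case: (_ \notin _); rewrite ?add1n ?add0n //.
have vS : v \in nbhd G H v by rewrite inE vH !inE eqxx.
have cS : (#|nbhd G H v| <= (2 * d).+1)%N.
  apply: leq_trans (subset_leq_card (subsetDl _ _)) _.
  by apply: leq_trans (cN v) _; rewrite ltnS.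
split => //.
apply: leq_trans (_ : \sum_(x in nbhd G H v) 2 ^ D <= _)%N; last first.
  by rewrite sum_nat_const leq_mul2r cS orbT.
apply: leq_trans (_ : \sum_(x in nbhd G H v) #|x |: [set u | adj G x u]| <= _)%N;
  last first.
  apply: leq_sum => x; rewrite !inE -ltnNge => /andP [xH _].
  exact: leq_trans (cN x) _.
apply: leq_trans (card_bigcup_le _ _); apply: subset_leq_card.
apply/fintype.subsetP => u; rewrite inE cover_imset => uv; apply/bigcupP.
move: uv => /orP [/eqP ->|]; first by exists v; rewrite // !inE eqxx.
move=> /pred0Pn [x /= /andP [xu xv]]; exists x => //.
by move: xu; rewrite !inE eq_sym adj_sym => /andP [].
Qed.

Lemma prod_lonely (T : finType) (S : T -> {set T}) (A : seq T) (X : {set T}) :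
  (2 ^ size A = 2 ^ count (fun v => lonely S v X) A *
    \prod_(v <- A) (if lonely S v X then 1 else 2))%N.
Proof.
elim: A => [|v A IH]; first by rewrite big_nil.
rewrite big_cons /= expnS IH expnD; case: (lonely S v X) => /=.
  by rewrite expn1 mul1n mulnA.
by rewrite expn0 mul1n mulnCA.
Qed.

(** A Markov-type bound: by [count_lonely] every set of [Fam] has weight at least
    [2 ^ size A / 2 ^ #|H|.+1], while [lonely_weight] bounds the total weight of all sets. *)
Lemma reachable_weight (n : nat) (G : sgraph n) (z : 'I_n) (H : {set 'I_n})
    (A : seq 'I_n) (t : nat) (Fam : {set {set 'I_n}}) :
  uniq A -> {in A, forall v, v \in nbhd G H v /\ (#|nbhd G H v| <= t)%N} ->
  {in A &, forall u v, u != v -> [disjoint nbhd G H u & nbhd G H v]} ->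
  (forall X, X \in Fam -> exists2 p, simple_path G z p & X = [set x in z :: p]) ->
  (#|Fam| * (2 ^ t.+1) ^ size A
     <= 2 ^ #|H|.+1 * (2 ^ t.+1).-1 ^ size A * 2 ^ n)%N.
Proof.
move=> uA HS HD HF; have := lonely_weight uA HS HD; rewrite card_ord.
set W := (\sum_X _)%N => hW.
have FW : (#|Fam| * 2 ^ size A <= 2 ^ #|H|.+1 * W)%N.
  rewrite -sum_nat_const; apply: leq_trans (_ : \sum_(X in Fam) 2 ^ #|H|.+1 *
     \prod_(v <- A) (if lonely (nbhd G H) v X then 1 else 2) <= _)%N.
    apply: leq_sum => X /HF [p sp XE].
    rewrite (prod_lonely (nbhd G H) A X) leq_mul2r; apply/orP; right.
    by rewrite leq_exp2l // XE count_lonely.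
  rewrite -big_distrr leq_mul2l; apply/orP; right.
  by rewrite big_mkcond; apply: leq_sum => X _; case: ifP.
rewrite -(@leq_pmul2r (2 ^ size A)) ?expn_gt0 //.
move: ((2 ^ t.+1) ^ size A)%N ((2 ^ t.+1).-1 ^ size A)%N hW FW => a b.
move: (2 ^ size A)%N (2 ^ #|H|.+1)%N (2 ^ n)%N => x y w hW FW.
apply: leq_trans (_ : y * W * a <= _)%N; first by rewrite mulnAC leq_mul2r FW orbT.
rewrite -mulnA (mulnC W).
have -> : (y * b * w * x = y * (x * b * w))%N by lia.
by rewrite leq_mul2l hW orbT.
Qed.

(* Let t = 2d + 1 bound the low degrees and q = 2^(t+1).  A dyadic threshold
   2^j makes the set H of vertices of degree at least 2^j small compared with
   a maximal family A of low-degree vertices whose neighbourhoods are disjoint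
   outside H. *)
Lemma reachable_sets_bound (d : nat) : exists2 W : nat, (0 < W)%N &
  forall (n : nat) (G : sgraph n) (z : 'I_n) (Fam : {set {set 'I_n}}),
  (\sum_v deg G v <= d * n)%N ->
  (forall X, X \in Fam -> exists2 p, simple_path G z p & X = [set x in z :: p]) ->
  (#|Fam| ^ W * 2 ^ n <= 2 ^ (W * n.+1))%N.
Proof.
(* [M] is [4 * t] times [2 * q]: the first factor is lost in the greedy choice of [A], the second is
   the ratio between [A] and [H] that [reachable_powers] requires. [E] bounds [n / size A], the
   scale [j] being at most [2 * d * M]. *)
pose t := (2 * d).+1; pose q := (2 ^ t.+1)%N; pose M := (8 * t * q)%N.
pose E := (4 * t * 2 ^ (2 * d * M))%N.
have qE : q = q.-1.+1 by rewrite prednK // expn_gt0.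
have q1 : (0 < q.-1)%N.
  by rewrite -ltnS -qE /q -[1%N](expn0 2) ltn_exp2l.
have E0 : (0 < E)%N by rewrite !muln_gt0 /= expn_gt0.
exists (2 * q * E)%N => [|n G z Fam degs HF]; first by rewrite muln_gt0 E0 andbT muln_gt0 expn_gt0.
have n0 : (0 < n)%N by apply: leq_trans (ltn_ord z).
have [||j jJ hj] := @dyadic_threshold 'I_n (deg G) d M; rewrite ?card_ord //.
set H := [set v | _] in hj; rewrite card_ord in hj.
pose L := [set v | (deg G v <= 2 * d)%N]; pose U := L :\: H.
have hL : (n <= 2 * #|L|)%N := card_low_degree degs.
have j0 : (0 < 2 ^ j)%N by rewrite expn_gt0.
have t0 : (0 < t)%N by [].
have q0 : (0 < q)%N by rewrite qE.
have hH : (4 * #|H| <= n)%N.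
  apply: leq_trans hj; rewrite mulnA leq_mul2r /M; apply/orP; right.
  by move: (2 ^ j)%N j0 => x; nia.
have hU : (n <= 4 * #|U|)%N.
  have : (#|L| <= #|U| + #|H|)%N.
    by rewrite -(cardsID H L) addnC leq_add2l subset_leq_card // subsetIr.
  lia.
pose r u v := (u == v) || ~~ [disjoint nbhd G H u & nbhd G H v].
have rr : reflexive r by move=> u; rewrite /r eqxx.
have rs : symmetric r by move=> u v; rewrite /r eq_sym disjoint_sym.
have UP v : v \in U -> v \notin H /\ (deg G v <= 2 * d)%N.
  by rewrite inE => /andP [-> ]; rewrite inE.
have [|A [uA AU ind cU]] := @greedy_independent _ r (t * 2 ^ j) U rr rs.
  move=> v /UP [vH dv]; have [_ _ h] := nbhd_props vH dv.
  apply: leq_trans h; apply: eq_leq; apply: eq_card => u; by rewrite !inE rs.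
have HS : {in A, forall v, v \in nbhd G H v /\ (#|nbhd G H v| <= t)%N}.
  by move=> v /AU /UP [vH dv]; have [] := nbhd_props vH dv.
have HD : {in A &, forall u v, u != v -> [disjoint nbhd G H u & nbhd G H v]}.
  by move=> u v uA' vA uv; have := ind u v uA' vA uv; rewrite negb_or negbK => /andP [].
have hF := reachable_weight uA HS HD HF.
have hA : (n <= 4 * t * 2 ^ j * size A)%N.
  by apply: leq_trans hU _; move: cU; move: (2 ^ j)%N j0 => x; lia.
have hHA : (2 * q * #|H| <= size A)%N.
  have : (M * (2 ^ j * #|H|) <= 4 * t * 2 ^ j * size A)%N := leq_trans hj hA.
  rewrite (_ : M * (2 ^ j * #|H|) = 4 * t * 2 ^ j * (2 * q * #|H|))%N.
    by rewrite leq_pmul2l // !muln_gt0 j0.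
  by rewrite /M; lia.
rewrite -/q [in X in (_ * X ^ _ <= _)%N]qE in hF.
have h := reachable_powers q1 hF (leqnn _); rewrite -qE in h.
have {}h := h hHA.
have EA : (n <= size A * E)%N.
  apply: leq_trans hA _; rewrite mulnC leq_mul2l; apply/orP; right.
  by rewrite /E leq_mul2l leq_exp2l // jJ orbT.
(* The power [E] turns the gain [2 ^ size A] into at least [2 ^ n], whence the exponent
   [2 * q * E]. *)
have : ((#|Fam| ^ (2 * q) * 2 ^ size A) ^ E <= (2 ^ (2 * q + 2 * n * q)) ^ E)%N.
  by rewrite leq_exp2r.
rewrite expnMn -!expnM => hE.
apply: leq_trans (_ : #|Fam| ^ (2 * q * E) * 2 ^ (size A * E) <= _)%N.
  by rewrite leq_mul2l leq_exp2l // EA orbT.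
apply: leq_trans hE _; rewrite leq_exp2l //; lia.
Qed.

(** * Cost of programs *)

(** [B] is a common bound on the bit lengths of all cells. Under logarithmic cost it controls the
    price of every elementary operation. *)
Definition bounded (R : realType) (B : nat) (s : state R) :=
  forall a i, (nmem s a i < 2 ^ B)%N.

Fixpoint loop_free (p : cmd) : bool :=
  match p with
  | Seq p q | If _ p q => loop_free p && loop_free q
  | While _ _ => false
  | _ => true
  end.

(* Only meaningful on loop-free programs; loops are skipped. *)
Fixpoint run (R : realType) (s : state R) (p : cmd) : state R :=
  match p with
  | Skip => s
  | NSet a i e => State (upd (nmem s) a (neval s i) (neval s e)) (rmem s)
  | RSet a i e => State (nmem s) (upd (rmem s) a (neval s i) (reval s e))
  | Seq p q => run (run s p) q
  | If b p q => if beval s b then run s p else run s q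
  | While _ _ => s
  end.

Lemma bounded_le (R : realType) (B B' : nat) (s : state R) :
  (B <= B')%N -> bounded B s -> bounded B' s.
Proof. by move=> BB' h a i; apply: leq_trans (h a i) _; rewrite leq_exp2l. Qed.

Lemma bounded_upd (R : realType) (B a i v : nat) (s : state R)
    (m : nat -> nat -> R) :
  bounded B s -> (v < 2 ^ B)%N -> bounded B (State (upd (nmem s) a i v) m).
Proof. by move=> h hv b j; rewrite /upd /=; case: ifP. Qed.

Lemma bitlen_le (x K : nat) : (0 < K)%N -> (x < 2 ^ K)%N -> (bitlen x <= K)%N.
Proof.
move=> K0 xK; have [->|x0] := posnP x; first by rewrite /bitlen trunc_log0.
by rewrite /bitlen -(@ltn_exp2l 2) //; apply: leq_ltn_trans (trunc_logP _ x0) xK.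
Qed.

Lemma bop_eval_lt (o : binop) (x y a b : nat) :
  (x < 2 ^ a)%N -> (y < 2 ^ b)%N -> (bop_eval o x y < 2 ^ (a + b))%N.
Proof.
move=> xa yb; rewrite expnD.
have xl : (x < 2 ^ a * 2 ^ b)%N.
  by apply: leq_trans xa _; rewrite leq_pmulr // expn_gt0.
case: o => /=.
- by move: (2 ^ a)%N (2 ^ b)%N xa yb => A B; nia.
- exact: leq_ltn_trans (leq_subr _ _) xl.
- by move: (2 ^ a)%N (2 ^ b)%N xa yb => A B; nia.
- exact: leq_ltn_trans (leq_div _ _) xl.
- exact: leq_ltn_trans (leq_mod _ _) xl.
Qed.

(** Bit lengths at most add up under an operation, and a memory read brings them back to [B]. Hence
    value length and cost are linear in [B], with a factor that depends on the expression alone. *)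
Lemma ncost_bound (e : nexpr) : exists2 K : nat, (0 < K)%N &
  forall (R : realType) (s : state R) (B : nat), (0 < B)%N -> bounded B s ->
  (neval s e < 2 ^ (K * B))%N /\ (ncost s e <= K * B)%N.
Proof.
elim: e => [k|a i [K K0 IH]|o e1 [K1 K10 IH1] e2 [K2 K20 IH2]].
- exists (bitlen k) => // R s B B0 _ /=; rewrite leq_pmulr //; split => //.
  apply: leq_trans (trunc_log_ltn k (isT : 1 < 2)%N) _.
  by rewrite leq_exp2l // leq_pmulr.
- exists (2 * K + 1)%N => [|R s B B0 hB]; first by rewrite addn1.
  have [h1 h2] := IH R s B B0 hB; split => /=.
    apply: leq_trans (hB _ _) _; rewrite leq_exp2l // leq_pmull //; lia.
  have := bitlen_le B0 (hB a (neval s i)).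
  have KB : (0 < K * B)%N by rewrite muln_gt0 K0.
  have := bitlen_le KB h1; lia.
- exists (2 * (K1 + K2))%N => [|R s B B0 hB]; first lia.
  have [h1 h2] := IH1 R s B B0 hB; have [h3 h4] := IH2 R s B B0 hB.
  split => /=.
    apply: leq_trans (bop_eval_lt o h1 h3) _; rewrite leq_exp2l //; lia.
  have KB1 : (0 < K1 * B)%N by rewrite muln_gt0 K10.
  have KB2 : (0 < K2 * B)%N by rewrite muln_gt0 K20.
  have := bitlen_le KB1 h1; have := bitlen_le KB2 h3; lia.
Qed.

Lemma rcost_bound (e : rexpr) : exists K : nat,
  forall (R : realType) (s : state R) (B : nat), (0 < B)%N -> bounded B s ->
  (rcost s e <= K * B)%N.
Proof.
elim: e => [|a i|e1 [K1 IH1] e2 [K2 IH2]|e1 [K1 IH1] e2 [K2 IH2]].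
- by exists 1%N => R s B B0 _ /=; rewrite mul1n.
- have [K K0 IH] := ncost_bound i; exists (2 * K + 1)%N => R s B B0 hB /=.
  have [h1 h2] := IH R s B B0 hB.
  have KB : (0 < K * B)%N by rewrite muln_gt0 K0.
  have := bitlen_le KB h1; lia.
- exists (K1 + K2 + 1)%N => R s B B0 hB /=.
  have := IH1 R s B B0 hB; have := IH2 R s B B0 hB; lia.
- exists (K1 + K2 + 1)%N => R s B B0 hB /=.
  have := IH1 R s B B0 hB; have := IH2 R s B B0 hB; lia.
Qed.

Lemma bcost_bound (b : bexpr) : exists K : nat,
  forall (R : realType) (s : state R) (B : nat), (0 < B)%N -> bounded B s ->
  (bcost s b <= K * B)%N.
Proof.
elim: b => [e1 e2|e1 e2|e1 e2|b [K IH]|b1 [K1 IH1] b2 [K2 IH2]].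
- have [K1 K10 IH1] := ncost_bound e1; have [K2 K20 IH2] := ncost_bound e2.
  exists (2 * (K1 + K2))%N => R s B B0 hB /=.
  have [h1 h2] := IH1 R s B B0 hB; have [h3 h4] := IH2 R s B B0 hB.
  have KB1 : (0 < K1 * B)%N by rewrite muln_gt0 K10.
  have KB2 : (0 < K2 * B)%N by rewrite muln_gt0 K20.
  have := bitlen_le KB1 h1; have := bitlen_le KB2 h3; lia.
- have [K1 K10 IH1] := ncost_bound e1; have [K2 K20 IH2] := ncost_bound e2.
  exists (2 * (K1 + K2))%N => R s B B0 hB /=.
  have [h1 h2] := IH1 R s B B0 hB; have [h3 h4] := IH2 R s B B0 hB.
  have KB1 : (0 < K1 * B)%N by rewrite muln_gt0 K10.
  have KB2 : (0 < K2 * B)%N by rewrite muln_gt0 K20.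
  have := bitlen_le KB1 h1; have := bitlen_le KB2 h3; lia.
- have [K1 IH1] := rcost_bound e1; have [K2 IH2] := rcost_bound e2.
  exists (K1 + K2 + 1)%N => R s B B0 hB /=.
  have := IH1 R s B B0 hB; have := IH2 R s B B0 hB; lia.
- exists (K + 1)%N => R s B B0 hB /=; have := IH R s B B0 hB; lia.
- exists (K1 + K2 + 1)%N => R s B B0 hB /=.
  have := IH1 R s B B0 hB; have := IH2 R s B B0 hB; lia.
Qed.

(** Each composition multiplies the bit bound by a constant. This is harmless for a fixed loop-free
    program, but it could not be iterated over a loop. *)
Lemma loop_free_exec (p : cmd) : loop_free p -> exists2 K : nat, (0 < K)%N &
  forall (R : realType) (s : state R) (B : nat), (0 < B)%N -> bounded B s ->
  exists2 t, exec p s (run s p) t & (t <= K * B)%N /\ bounded (K * B) (run s p).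
Proof.
elim: p => [_|a i e _|a i e _|p IHp q IHq /= /andP [/IHp [K1 K10 {}IHp] /IHq [K2 K20 {}IHq]]|
  b p IHp q IHq /= /andP [/IHp [K1 K10 {}IHp] /IHq [K2 K20 {}IHq]]|] //.
- exists 1%N => // R s B B0 hB; exists 1%N; first exact: exec_skip.
  by rewrite mul1n.
- have [K1 K10 IH1] := ncost_bound i; have [K2 K20 IH2] := ncost_bound e.
  exists (2 * (K1 + K2))%N => [|R s B B0 hB]; first lia.
  have [h1 h2] := IH1 R s B B0 hB; have [h3 h4] := IH2 R s B B0 hB.
  have KB1 : (0 < K1 * B)%N by rewrite muln_gt0 K10.
  have KB2 : (0 < K2 * B)%N by rewrite muln_gt0 K20.
  eexists; first exact: exec_nset; split.
    have := bitlen_le KB1 h1; have := bitlen_le KB2 h3; lia.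
  apply: bounded_upd; first by apply: bounded_le hB; nia.
  by apply: leq_trans h3 _; rewrite leq_exp2l //; nia.
- have [K1 K10 IH1] := ncost_bound i; have [K2 IH2] := rcost_bound e.
  exists (2 * K1 + K2 + 1)%N => [|R s B B0 hB]; first lia.
  have [h1 h2] := IH1 R s B B0 hB; have h4 := IH2 R s B B0 hB.
  have KB1 : (0 < K1 * B)%N by rewrite muln_gt0 K10.
  eexists; first exact: exec_rset; split.
    have := bitlen_le KB1 h1; lia.
  by move=> c j /=; apply: (@bounded_le _ B _ s) => //; nia.
- exists (K1 + K2 * K1)%N => [|R s B B0 hB]; first lia.
  have [t1 e1 [h1 b1]] := IHp R s B B0 hB.
  have KB1 : (0 < K1 * B)%N by rewrite muln_gt0 K10.
  have [t2 e2 [h2 b2]] := IHq R (run s p) _ KB1 b1.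
  exists (t1 + t2)%N; first exact: exec_seq e1 e2.
  split; first by nia.
  by apply: bounded_le b2; nia.
- have [K3 IH3] := bcost_bound b.
  exists (K1 + K2 + K3)%N => [|R s B B0 hB]; first lia.
  have h3 := IH3 R s B B0 hB.
  case: ifP => hb.
    have [t1 e1 [h1 b1]] := IHp R s B B0 hB.
    exists (bcost s b + t1)%N; first exact: exec_if_true.
    by split; [nia|apply: bounded_le b1; nia].
  have [t1 e1 [h1 b1]] := IHq R s B B0 hB.
  exists (bcost s b + t1)%N; first by apply: exec_if_false; rewrite ?hb.
  by split; [nia|apply: bounded_le b1; nia].
Qed.

(** The invariant re-establishes the bit bound [B] before every round, so the growth allowed by
    [loop_free_exec] never accumulates. The successor of [mu s] pays for the final failing test. *)
Lemma while_exec (b : bexpr) (p : cmd) : loop_free p -> exists K : nat,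
  forall (R : realType) (B : nat) (Inv : state R -> Prop) (mu : state R -> nat),
  (0 < B)%N -> (forall s, Inv s -> bounded B s) ->
  (forall s, Inv s -> beval s b -> Inv (run s p) /\ (mu (run s p) < mu s)%N) ->
  forall s, Inv s -> exists s' t, [/\ exec (While b p) s s' t, Inv s',
    ~~ beval s' b & (t <= K * B * (mu s).+1)%N].
Proof.
move=> /loop_free_exec [K1 K10 hp]; have [K2 hb] := bcost_bound b.
exists (K1 + K2)%N => R B Inv mu B0 bInv step s.
have [k] := ubnP (mu s); elim: k s => // k IH s sk Is.
have hB := bInv s Is; have hc := hb R s B B0 hB.
have [bs|bs] := boolP (beval s b); last first.
  exists s, (bcost s b); split => //; first exact: exec_while_false.
  by nia.
have [t1 e1 [h1 _]] := hp R s B B0 hB.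
have [Is' mus] := step s Is bs.
have [|s' [t [e2 Is2 nb ht]]] := IH (run s p) _ Is'; first by lia.
exists s', (bcost s b + t1 + t)%N; split => //.
  exact: exec_while_true e1 e2.
move: ht mus; move: (mu s) (mu _) => m m' ht mus.
have : ((K1 + K2) * B * m'.+1 + (K1 + K2) * B <= (K1 + K2) * B * m.+1)%N.
  by rewrite addnC -mulnS leq_mul2l ltnS mus orbT.
by lia.
Qed.

(** * Encoding of paths *)

Definition mask (n : nat) (h : seq 'I_n) : nat := (\sum_(x <- h) 2 ^ x)%N.

Definition key (n : nat) (z : 'I_n) (p : seq 'I_n) : nat :=
  (mask (z :: p) * n + last z p)%N.

(** A base-[n] numeral with the first vertex as leading digit. Leading zeros are lost, so decoding
    relies on knowing the length. *)
Definition pcode (n : nat) (h : seq 'I_n) : nat :=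
  foldl (fun a (x : 'I_n) => a * n + x)%N 0%N h.

Definition path_weight (R : realType) (n : nat) (c : {set 'I_n} -> R) (z : 'I_n)
    (p : seq 'I_n) : R :=
  \sum_(0 <= i < size p) c [set nth z (z :: p) i; nth z p i].

Lemma bit_sum (b : nat -> bool) (n w : nat) : (w < n)%N ->
  odd ((\sum_(i < n) b i * 2 ^ i) %/ 2 ^ w) = b w.
Proof.
elim: n b w => // n IH b w wn; rewrite big_ord_recl expn0 muln1.
rewrite (eq_bigr (fun i : 'I_n => 2 * (b i.+1 * 2 ^ i)))%N; last first.
  by move=> i _; rewrite /= /bump add1n expnS mulnCA.
rewrite -big_distrr /=; case: w wn => [|w] wn.
  by rewrite expn0 divn1 oddD oddM /= addbF oddb.
rewrite expnS divnMA -(IH (fun i => b i.+1)) //.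
set S := (\sum_(i < n) _)%N; congr (odd (_ %/ _)).
by case: (b _); lia.
Qed.

Lemma bit_sum_lt (b : nat -> bool) (n : nat) :
  (\sum_(i < n) b i * 2 ^ i < 2 ^ n)%N.
Proof.
elim: n => [|n IH]; first by rewrite big_ord0.
rewrite big_ord_recr /= expnS; have := leq_b1 (b n).
by move: (2 ^ n)%N (b n : nat) (\sum_(i < n) _)%N IH => A x S; nia.
Qed.

Lemma maskE (n : nat) (h : seq 'I_n) : uniq h ->
  mask h = (\sum_(i < n) (nat_of_ord i \in [seq val x | x <- h]) * 2 ^ i)%N.
Proof.
move=> uh; rewrite /mask big_uniq //= big_mkcond; apply: eq_bigr => i _.
by rewrite mem_map; [case: ifP; rewrite ?mul1n|exact: val_inj].
Qed.

Lemma mask_bit (n : nat) (h : seq 'I_n) (w : 'I_n) : uniq h ->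
  odd (mask h %/ 2 ^ w) = (w \in h).
Proof.
move=> uh; rewrite maskE // (bit_sum (fun i => i \in [seq val x | x <- h])) //.
by rewrite mem_map //; exact: val_inj.
Qed.

Lemma mask_lt (n : nat) (h : seq 'I_n) : uniq h -> (mask h < 2 ^ n)%N.
Proof. by move=> uh; rewrite maskE // (bit_sum_lt (fun i => i \in _)). Qed.

Lemma mask_inj (n : nat) (h h' : seq 'I_n) : uniq h -> uniq h' ->
  mask h = mask h' -> h =i h'.
Proof. by move=> uh uh' e w; rewrite -!mask_bit // e. Qed.

Lemma mask_mem (n : nat) (h h' : seq 'I_n) : uniq h -> uniq h' ->
  h =i h' -> mask h = mask h'.
Proof. by move=> uh uh' e; rewrite /mask !big_uniq //=; apply: eq_bigl. Qed.

(** Masks determine vertex sets, and the set of all vertices has mask [2 ^ n - 1]; so one comparison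
    of numbers tells whether a path is Hamiltonian. *)
Lemma mask_full (n : nat) (h : seq 'I_n) : uniq h ->
  ((mask h).+1 == 2 ^ n)%N = (size h == n).
Proof.
move=> uh; have ue : uniq (enum 'I_n) := enum_uniq _.
have me : ((mask (enum 'I_n)).+1 = 2 ^ n)%N.
  rewrite /mask big_enum /=; elim: (n) => [|k IH]; first by rewrite big_ord0.
  by rewrite big_ord_recr /= -addSn IH addnn -mul2n expnS.
rewrite -{1}me eqSS; apply/eqP/eqP => [/(mask_inj uh ue) e|sh].
  by rewrite (perm_size (uniq_perm uh ue e)) size_enum_ord.
apply: mask_mem => //.
by have [] := uniq_min_size uh (s2 := enum 'I_n) (fun x _ => mem_enum 'I_n x) _;
  rewrite ?size_enum_ord ?sh.
Qed.

Lemma key_div (n : nat) (z : 'I_n) (p : seq 'I_n) : (key z p %/ n)%N = mask (z :: p).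
Proof.
have n0 : (0 < n)%N by apply: leq_trans (ltn_ord z).
by rewrite /key divnMDl // divn_small ?addn0.
Qed.

Lemma key_mod (n : nat) (z : 'I_n) (p : seq 'I_n) : (key z p %% n)%N = last z p.
Proof. by rewrite /key modnMDl modn_small. Qed.

Lemma key_inj (n : nat) (z : 'I_n) (p p' : seq 'I_n) :
  uniq (z :: p) -> uniq (z :: p') -> key z p = key z p' ->
  (z :: p =i z :: p') /\ last z p = last z p'.
Proof.
move=> u u' e; split; first by apply: mask_inj; rewrite -?key_div ?e.
by apply: val_inj; rewrite /= -!key_mod e.
Qed.

Lemma key_mem (n : nat) (z : 'I_n) (p p' : seq 'I_n) :
  uniq (z :: p) -> uniq (z :: p') ->
  (z :: p =i z :: p') -> last z p = last z p' -> key z p = key z p'.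
Proof. by move=> u u' e l; rewrite /key l (mask_mem u u' e). Qed.

Lemma key_rcons (n : nat) (z w : 'I_n) (p : seq 'I_n) :
  key z (rcons p w) = ((mask (z :: p) + 2 ^ w) * n + w)%N.
Proof.
rewrite /key last_rcons -rcons_cons /mask -cats1 big_cat big_seq1; congr (_ + _)%N.
Qed.

Lemma key_lt (n : nat) (z : 'I_n) (p : seq 'I_n) :
  uniq (z :: p) -> (key z p < 2 ^ n * n)%N.
Proof.
move=> /mask_lt; rewrite /key; have := ltn_ord (last z p).
move: (2 ^ n)%N (mask _) (last z p : nat) => A m l; nia.
Qed.

Lemma pcode_rcons (n : nat) (h : seq 'I_n) (w : 'I_n) :
  pcode (rcons h w) = (pcode h * n + w)%N.
Proof. by rewrite /pcode -cats1 foldl_cat. Qed.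

Lemma pcode_lt (n : nat) (h : seq 'I_n) : (pcode h < n ^ size h)%N.
Proof.
elim/last_ind: h => [|h w IH] //; rewrite pcode_rcons size_rcons expnS.
have := ltn_ord w; move: (n ^ _)%N (pcode h) IH => A m; nia.
Qed.

Lemma path_weight_rcons (R : realType) (n : nat) (c : {set 'I_n} -> R)
    (z w : 'I_n) (p : seq 'I_n) :
  path_weight c z (rcons p w) = path_weight c z p + c [set last z p; w].
Proof.
rewrite /path_weight size_rcons big_nat_recr //=; congr (_ + c _); last first.
  by rewrite -rcons_cons !nth_rcons /= ltnSn ltnn eqxx (last_nth z).
apply: eq_big_nat => i /andP [_ ip].
by rewrite -rcons_cons !nth_rcons /= ltnS ltnW // ip.
Qed.

Lemma cycle_weight_cons (R : realType) (n : nat) (c : {set 'I_n} -> R)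
    (z : 'I_n) (p : seq 'I_n) : uniq (z :: p) ->
  cycle_weight c (z :: p) = path_weight c z p + c [set last z p; z].
Proof.
move=> u; rewrite /cycle_weight (big_nth z).
(* At the last index [nth z p] runs past the end, and its default [z] is exactly the cyclic
   successor. *)
have nx i : (i < size (z :: p))%N -> next (z :: p) (nth z (z :: p) i) = nth z p i.
  by move=> ip; rewrite next_nth mem_nth // index_uniq.
rewrite (eq_big_nat _ _ (F2 := fun i => c [set nth z (z :: p) i; nth z p i]));
  last by move=> i /andP [_ ip]; rewrite nx.
rewrite big_nat_recr //=; congr (_ + c _).
by rewrite [nth z p _]nth_default // (last_nth z).
Qed.

Lemma simple_path_rcons (n : nat) (G : sgraph n) (z w : 'I_n) (p : seq 'I_n) :
  simple_path G z (rcons p w) =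
    [&& simple_path G z p, adj G (last z p) w & w \notin z :: p].
Proof.
rewrite /simple_path rcons_path -rcons_cons rcons_uniq.
by case: path; case: adj; rewrite ?andbF //= andbC.
Qed.

Definition reachable_sets (n : nat) (G : sgraph n) (z : 'I_n) : {set {set 'I_n}} :=
  [set X | `[< exists2 p, simple_path G z p & X = [set x in z :: p] >]].

(** Links the queue to the counting bound: paths with distinct keys differ in their vertex set or in
    their end, and there are [n] possible ends. *)
Lemma size_keys (n : nat) (G : sgraph n) (z : 'I_n) (Q : seq (seq 'I_n)) :
  all (simple_path G z) Q -> uniq [seq key z p | p <- Q] ->
  (size Q <= #|reachable_sets G z| * n)%N.
Proof.
move=> /allP sQ uQ; pose f p := ([set x in z :: p], last z p).
have <- : size [seq f p | p <- Q] = size Q by rewrite size_map.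
rewrite -[X in (_ * X)%N]card_ord -cardsT -cardsX cardE.
apply: uniq_leq_size.
  rewrite map_inj_in_uniq; first exact: map_uniq uQ.
  move=> p p' pQ pQ' [/setP e l].
  have /andP [_ u] := sQ _ pQ; have /andP [_ u'] := sQ _ pQ'.
  have k : key z p = key z p'.
    by apply: key_mem => // x; have := e x; rewrite !inE.
  by rewrite -(nth_index [::] pQ) -(nth_index [::] pQ'); congr nth;
     apply/eqP; rewrite -(nth_uniq 0%N _ _ uQ) ?size_map ?index_mem //
       !(nth_map [::]) ?index_mem // !nth_index // k.
move=> _ /mapP [p pQ ->]; rewrite mem_enum !inE andbT.
by apply/asboolP; exists p; rewrite ?sQ.
Qed.

(** * The search on lists of paths *)

Section Search.
Variables (R : realType) (n : nat) (G : sgraph n) (c : {set 'I_n} -> R).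
Variable z : 'I_n.

Notation weight := (path_weight c z).
Notation keys Q := [seq key z p | p <- Q].
Notation simple := (simple_path G z).

Definition closes (p : seq 'I_n) := ((size p).+1 == n) && adj G (last z p) z.

Definition closed_weight (p : seq 'I_n) := weight p + c [set last z p; z].

Definition enqueue (Q : seq (seq 'I_n)) (g : seq 'I_n) :=
  if key z g \in keys Q then
    [seq if (key z p == key z g) && (weight g < weight p) then g else p | p <- Q]
  else rcons Q g.

Definition improve (bst : option (seq 'I_n)) (p : seq 'I_n) :=
  if bst is Some b then
    if closed_weight b <= closed_weight p then Some b else Some p
  else Some p.

(** Held-Karp dominance: the key of a path decides how it can be extended, so a cheaper path with
    the same key can stand in for it. *)
Definition covered (Q : seq (seq 'I_n)) (p : seq 'I_n) :=
  exists2 g, g \in Q & key z g = key z p /\ weight g <= weight p.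

(* [Q] lists the best path found so far to each state, in the order of
   discovery; the first [hd] of them, and the [hd]-th with respect to the
   vertices below [w], have been extended. *)
Record search_inv (Q : seq (seq 'I_n)) (hd w : nat) (bst : option (seq 'I_n)) :
    Prop := SearchInv {
  inv_simple : all simple Q;
  inv_uniq : uniq (keys Q);
  inv_root : covered Q [::];
  inv_hd : (hd <= size Q)%N;
  inv_w : (w <= n)%N;
  inv_sorted : forall i j, (i <= j < size Q)%N ->
    (size (nth [::] Q i) <= size (nth [::] Q j))%N;
  inv_top : forall j, (hd < size Q)%N -> (j < size Q)%N ->
    (size (nth [::] Q j) <= (size (nth [::] Q hd)).+1)%N;
  inv_closed : forall i (u : 'I_n), (i < size Q)%N ->
    (i < hd)%N \/ i = hd /\ (u < w)%N ->
    simple (rcons (nth [::] Q i) u) -> covered Q (rcons (nth [::] Q i) u);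
  inv_best : forall i, (i < hd)%N -> closes (nth [::] Q i) ->
    exists2 b, bst = Some b & closed_weight b <= closed_weight (nth [::] Q i);
  inv_bst : forall b, bst = Some b -> simple b /\ closes b
}.

Lemma search_inv0 : search_inv [:: [::]] 0 0 None.
Proof.
split=> //; first by exists [::]; rewrite ?mem_head.
- by move=> [|i] [|j] //; rewrite andbF.
- by case=> [|j] _ /=; rewrite ?ltnS ?ltn0.
- by move=> i u _ [|[_]]; rewrite ltn0.
Qed.

Lemma simple_key_size (p p' : seq 'I_n) : simple p -> simple p' ->
  key z p = key z p' -> size p = size p'.
Proof.
move=> /andP [_ u] /andP [_ u'] /(key_inj u u') [e _].
by have [] := perm_size (uniq_perm u u' e).
Qed.

Lemma covered_enqueue Q g p : covered Q p -> covered (enqueue Q g) p.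
Proof.
move=> [h hQ [hk hw]]; rewrite /enqueue; case: ifP => _; last first.
  by exists h; rewrite // mem_rcons inE hQ orbT.
have [/andP [/eqP kg wg]|ng] := boolP ((key z h == key z g) && (weight g < weight h)).
  exists g; last by rewrite -kg hk; split=> //; apply: le_trans (ltW wg) hw.
  by apply/mapP; exists h; rewrite // kg eqxx wg.
by exists h => //; apply/mapP; exists h; rewrite // (negbTE ng).
Qed.

Lemma covered_enqueue_self Q g : covered (enqueue Q g) g.
Proof.
rewrite /enqueue; case: ifP => [/mapP [h hQ kg]|_]; last first.
  by exists g; rewrite // mem_rcons mem_head.
have [wg|wg] := ltP (weight g) (weight h).
  by exists g => //; apply/mapP; exists h; rewrite // kg eqxx wg.
by exists h; [apply/mapP; exists h; rewrite // kg eqxx ltNge wg|].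
Qed.

Lemma size_enqueue Q g : (size Q <= size (enqueue Q g))%N.
Proof. by rewrite /enqueue; case: ifP => _; rewrite ?size_map ?size_rcons. Qed.

Lemma keys_enqueue Q g :
  keys (enqueue Q g) = if key z g \in keys Q then keys Q else rcons (keys Q) (key z g).
Proof.
rewrite /enqueue; case: ifP => _; last by rewrite map_rcons.
by rewrite -map_comp; apply: eq_map => p /=; case: ifP => // /andP [/eqP ->].
Qed.

Lemma nth_enqueue Q g i : (i < size Q)%N ->
  nth [::] (enqueue Q g) i =
    if (key z (nth [::] Q i) == key z g) && (weight g < weight (nth [::] Q i))
    then g else nth [::] Q i.
Proof.
move=> iQ; rewrite /enqueue; case: ifP => [_|gQ].
  by rewrite (nth_map [::]).
rewrite nth_rcons iQ; case: eqP => //= kg.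
by move: gQ; rewrite -kg map_f // mem_nth.
Qed.

Lemma all_enqueue Q g : simple g -> all simple Q -> all simple (enqueue Q g).
Proof.
move=> sg sQ; rewrite /enqueue; case: ifP => _; last by rewrite all_rcons sg.
apply/allP => _ /mapP [p pQ ->]; case: ifP => // _.
by move/allP: sQ; apply.
Qed.

Lemma search_skip Q hd (u : 'I_n) bst : search_inv Q hd u bst ->
  ~~ simple (rcons (nth [::] Q hd) u) -> search_inv Q hd u.+1 bst.
Proof.
case=> sQ uQ rt hhd hw srt top cl bs bb ns; split => //.
move=> i v iQ iv si; apply: cl => //; case: iv => [|[ih vu]]; first by left.
right; split => //; move: vu; rewrite ltnS leq_eqVlt => /orP [/eqP e|//].
by move: ns; rewrite -ih -(val_inj e) si.
Qed.

(** Breadth-first order is essential here. A key determines the length of its path, and [g] is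
    longer than every entry up to the head, so no entry that has already been expanded is
    replaced. *)
Lemma search_extend Q hd (u : 'I_n) bst : search_inv Q hd u bst ->
  (hd < size Q)%N -> simple (rcons (nth [::] Q hd) u) ->
  search_inv (enqueue Q (rcons (nth [::] Q hd) u)) hd u.+1 bst.
Proof.
case=> sQ uQ rt hhd hw srt top cl bs bb hQ sg.
set g := rcons _ u in sg *.
have szg : size g = (size (nth [::] Q hd)).+1 by rewrite size_rcons.
have sQi i : (i < size Q)%N -> simple (nth [::] Q i).
  by move=> iQ; move/allP: sQ; apply; apply: mem_nth.
have szi i : (i < size Q)%N -> size (nth [::] (enqueue Q g) i) = size (nth [::] Q i).
  move=> iQ; rewrite nth_enqueue //; case: ifP => // /andP [/eqP k _].
  by apply: esym; apply: simple_key_size => //; exact: sQi.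
have lo i : (i <= hd)%N -> nth [::] (enqueue Q g) i = nth [::] Q i.
  move=> ih; have iQ := leq_ltn_trans ih hQ.
  rewrite nth_enqueue //; case: ifP => // /andP [/eqP k _].
  have := simple_key_size (sQi i iQ) sg k; rewrite szg => e.
  by have := srt i hd; rewrite ih hQ e ltnn => /(_ isT).
have szE : size (enqueue Q g) = size Q \/
    size (enqueue Q g) = (size Q).+1 /\ nth [::] (enqueue Q g) (size Q) = g.
  rewrite /enqueue; case: ifP => _; first by left; rewrite size_map.
  by right; rewrite size_rcons nth_rcons ltnn eqxx.
(* No entry is longer than [g], so appending [g] at the end keeps the queue sorted by length. *)
have topg j : (j < size (enqueue Q g))%N ->
    (size (nth [::] (enqueue Q g) j) <= size g)%N.
  have [jQ _|jQ] := ltnP j (size Q); first by rewrite szi // szg; apply: top.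
  case: szE => [->|[-> eg]]; first by rewrite ltnNge jQ.
  by rewrite ltnS => jQ'; rewrite (_ : j = size Q) ?eg //; apply/eqP; rewrite eqn_leq jQ jQ'.
split.
- exact: all_enqueue.
- by rewrite keys_enqueue; case: ifP => // kn; rewrite rcons_uniq kn.
- exact: covered_enqueue.
- exact: leq_trans hhd (size_enqueue _ _).
- exact: ltn_ord.
- move=> i j /andP [ij jE].
  have [jQ|jQ] := ltnP j (size Q).
    by rewrite !szi ?(leq_ltn_trans ij) //; apply: srt; rewrite ij.
  case: szE jE => [->|[-> eg]]; first by rewrite ltnNge jQ.
  rewrite ltnS => jQ'; have {jQ jQ'} jE : j = size Q by apply/eqP; rewrite eqn_leq jQ jQ'.
  move: ij; rewrite jE eg leq_eqVlt => /orP [/eqP ->|iQ]; first by rewrite eg.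
  by rewrite szi // szg; apply: top.
- by move=> j _ jE; rewrite (lo hd) // -szg; apply: topg.
- move=> i v _ iv; have ih : (i <= hd)%N by case: iv => [/ltnW //|[-> _]].
  have iQ := leq_ltn_trans ih hQ.
  rewrite lo // => si; case: iv => [ih'|[ie vu]].
    by apply: covered_enqueue; apply: cl => //; left.
  move: vu; rewrite ltnS leq_eqVlt => /orP [/eqP e|vu].
    by rewrite ie (val_inj e); exact: covered_enqueue_self.
  by apply: covered_enqueue; apply: cl => //; right.
- by move=> i ih; rewrite lo ?(ltnW ih) //; apply: bs.
- exact: bb.
Qed.

Lemma search_next Q hd bst : search_inv Q hd n bst -> (hd < size Q)%N ->
  search_inv Q hd.+1 0
    (if closes (nth [::] Q hd) then improve bst (nth [::] Q hd) else bst).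
Proof.
case=> sQ uQ rt hhd hw srt top cl bs bb hQ.
have shd : simple (nth [::] Q hd) by move/allP: sQ; apply; apply: mem_nth.
split => //.
- move=> j hQ' jQ; apply: leq_trans (top j hQ jQ) _.
  by rewrite ltnS; apply: srt; rewrite leqnSn.
- move=> i u iQ [ih|[_ //]]; apply: cl => //.
  by move: ih; rewrite ltnS leq_eqVlt => /orP [/eqP ->|ih]; [right|left].
- move=> i; rewrite ltnS leq_eqVlt => /orP [/eqP -> ch|ih ci].
    rewrite ch /improve; case: bst {bs bb} => [b|]; last by eexists.
    by case: leP => [h|h]; [exists b|eexists].
  have [b -> hb] := bs i ih ci; case: ifP => _ /=; last by exists b.
  case: leP => h; first by exists b.
  by eexists; [reflexivity|apply: le_trans (ltW h) hb].
- move=> b; case: ifP => [ch|_]; last exact: bb.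
  rewrite /improve; case: bst bb {bs} => [b'|] bb.
    by case: ifP => _ [<-]; [apply: bb|split].
  by case=> <-; split.
Qed.

(** Bellman's principle: the prefix of [p] is replaced by the stored path [g] with the same key.
    That path visits the same vertices and has the same end, so the last vertex can still be
    appended, at no greater total weight. *)
Lemma search_complete Q w bst p : search_inv Q (size Q) w bst -> simple p ->
  covered Q p.
Proof.
case=> sQ uQ rt _ _ _ _ cl _ _.
elim/last_ind: p => // p u IH; rewrite simple_path_rcons => /and3P [sp ap up].
have [g gQ [kg wg]] := IH sp.
have sg : simple g by move/allP: sQ; apply.
have /andP [_ ug] := sg; have /andP [_ up'] := sp.
have [mg lg] := key_inj ug up' kg.
have sgu : simple (rcons g u) by rewrite simple_path_rcons sg lg ap mg up.
have gi : (index g Q < size Q)%N by rewrite index_mem.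
have := cl (index g Q) u gi (or_introl gi); rewrite nth_index // => /(_ sgu).
move=> [h hQ [kh wh]]; exists h => //; split.
  by rewrite kh !key_rcons -!key_div kg.
by apply: le_trans wh _; rewrite !path_weight_rcons lg lerD2r.
Qed.

Lemma search_optimal Q w bst p : search_inv Q (size Q) w bst -> simple p ->
  closes p -> exists2 b, bst = Some b & closed_weight b <= closed_weight p.
Proof.
move=> inv sp cp; have [g gQ [kg wg]] := search_complete inv sp.
case: inv => sQ _ _ _ _ _ _ _ bs _.
have sg : simple g by move/allP: sQ; apply.
have /andP [_ ug] := sg; have /andP [_ up] := sp.
have [_ lg] := key_inj ug up kg.
have gi : (index g Q < size Q)%N by rewrite index_mem.
have := bs (index g Q) gi; rewrite nth_index // => /(_ _) [|b -> hb].
  by rewrite /closes (simple_key_size sg sp kg) lg.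
by exists b => //; apply: le_trans hb _; rewrite /closed_weight lg lerD2r.
Qed.

End Search.

(** * The program and its refinement *)

(* A search state is a pair of a vertex set and an end vertex, coded as
   (bit mask) * n + (end vertex).  Natural array 4 is the queue of discovered
   states; arrays 5 (path, in base n), 6 (discovered) and real array 1
   (distance) are indexed by states.  Natural array 7 holds the scalars: 0 head
   and 1 tail of the queue, 2 the next vertex w to try, 3 the value 2 ^ w, 4 the
   code of the best closed path, 5 the decoding counter.  Real array 2 holds
   the weight of the best cycle. *)
Definition eN := NGet 0 (NCst 0).
Definition scal k := NGet 7 (NCst k).
Definition eCur := NGet 4 (scal 0).
Definition eX := NBop Div eCur eN.
Definition eV := NBop Mod eCur eN.
Definition eIdx := NBop Add (NBop Mul eV eN) (scal 2).
Definition eKey := NBop Add (NBop Mul (NBop Add eX (scal 3)) eN) (scal 2).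
Definition eNew := RAdd (RGet 1 eCur) (RGet 0 eIdx).
Definition eBack := NBop Mul eV eN.
Definition eTot := RAdd (RGet 1 eCur) (RGet 0 eBack).

Definition set_path :=
  Seq (RSet 1 eKey eNew)
      (NSet 5 eKey (NBop Add (NBop Mul (NGet 5 eCur) eN) (scal 2))).
Definition push :=
  Seq (NSet 6 eKey (NCst 1))
  (Seq (NSet 4 (scal 1) eKey)
       (NSet 7 (NCst 1) (NBop Add (scal 1) (NCst 1)))).
Definition extend :=
  If (NEq (NGet 6 eKey) (NCst 0)) (Seq set_path push)
     (If (RLe (RGet 1 eKey) eNew) Skip set_path).
(* The second test reads bit w of the mask. *)
Definition extendable :=
  BAnd (NEq (NGet 1 eIdx) (NCst 1))
       (NEq (NBop Mod (NBop Div eX (scal 3)) (NCst 2)) (NCst 0)).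
Definition tick :=
  Seq (NSet 7 (NCst 2) (NBop Add (scal 2) (NCst 1)))
      (NSet 7 (NCst 3) (NBop Mul (scal 3) (NCst 2))).
(* Only evaluated at w = n, where it compares the mask with 2 ^ n - 1. *)
Definition closing :=
  BAnd (NEq (NBop Add eX (NCst 1)) (scal 3)) (NEq (NGet 1 eBack) (NCst 1)).
Definition set_best :=
  Seq (RSet 2 (NCst 0) eTot)
  (Seq (NSet 7 (NCst 4) (NGet 5 eCur)) (NSet 2 (NCst 0) (NCst 1))).
Definition set_if_better :=
  If (BAnd (NEq (NGet 2 (NCst 0)) (NCst 1)) (RLe (RGet 2 (NCst 0)) eTot))
     Skip set_best.
Definition advance :=
  Seq (NSet 7 (NCst 0) (NBop Add (scal 0) (NCst 1)))
  (Seq (NSet 7 (NCst 2) (NCst 0)) (NSet 7 (NCst 3) (NCst 1))).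
(* One iteration tries one vertex w < n, or, at w = n, leaves the head state. *)
Definition body :=
  If (NLe (NBop Add (scal 2) (NCst 1)) eN)
     (Seq (If extendable extend Skip) tick)
     (Seq (If closing set_if_better Skip) advance).
Definition pending := NLe (NBop Add (scal 0) (NCst 1)) (scal 1).
Definition init :=
  Seq (NSet 4 (NCst 0) eN)
  (Seq (NSet 6 eN (NCst 1))
  (Seq (NSet 7 (NCst 1) (NCst 1)) (NSet 7 (NCst 3) (NCst 1)))).
Definition start_decode := NSet 7 (NCst 5) eN.
Definition decode_body :=
  Seq (NSet 7 (NCst 5) (NBop Defs.Sub (scal 5) (NCst 1)))
  (Seq (NSet 3 (scal 5) (NBop Mod (scal 4) eN))
       (NSet 7 (NCst 4) (NBop Div (scal 4) eN))).
Definition undecoded := NLe (NCst 1) (scal 5).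
(** When [n <= 2] there is no cycle, and the untouched output flag already says so. *)
Definition tsp_program :=
  If (NLe eN (NCst 2)) Skip
    (Seq init (Seq (While pending body)
       (Seq start_decode (While undecoded decode_body)))).

(** This and the next three lemmas show that [n * n] bits suffice for the numbers that the program
    stores. The path codes are the reason for the square: up to [n] digits, each below
    [n < 2 ^ n]. *)
Lemma pow2_lt_bound n m : (2 < n)%N -> (m <= n)%N -> (2 ^ m < 2 ^ (n * n))%N.
Proof. by move=> n2 mn; rewrite ltn_exp2l //; nia. Qed.

Lemma queue_lt_bound n m : (2 < n)%N -> (m <= 2 ^ n * n)%N -> (m < 2 ^ (n * n))%N.
Proof.
move=> n2 mn; apply: leq_ltn_trans mn _.
apply: (@leq_trans (2 ^ n * 2 ^ n)%N); last by rewrite -expnD leq_exp2l //; nia.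
by rewrite ltn_pmul2l ?expn_gt0 // ltn_expl.
Qed.

Lemma small_lt_bound n m : (2 < n)%N -> (m <= n)%N -> (m < 2 ^ (n * n))%N.
Proof.
move=> n2 mn; apply: (queue_lt_bound n2); apply: leq_trans mn _.
by rewrite leq_pmull // expn_gt0.
Qed.

Lemma pcode_lt_bound n (h : seq 'I_n) : (2 < n)%N -> uniq h -> (pcode h < 2 ^ (n * n))%N.
Proof.
move=> n2 u; have hn : (size h <= n)%N.
  by rewrite -[n in (_ <= n)%N]card_ord cardE; apply: uniq_leq_size => // x _; rewrite mem_enum.
apply: leq_trans (pcode_lt h) _; apply: (@leq_trans (n ^ n)%N).
  by rewrite leq_pexp2l //; lia.
by rewrite expnM leq_exp2r ?(ltnW (ltn_expl _ _)) //; lia.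
Qed.

Section Refinement.
Variables (R : realType) (n : nat) (G : sgraph n) (c : {set 'I_n} -> R).
Variables (z : 'I_n).
Hypotheses (z0 : nat_of_ord z = 0%N) (n2 : (2 < n)%N).

Notation weight := (path_weight c z).
Notation simple := (simple_path G z).
Notation keys Q := [seq key z p | p <- Q].

Record input_rel (s : state R) : Prop := InputRel {
  rel_n : nmem s 0 0 = n;
  rel_adj : forall i j : 'I_n, nmem s 1 (i * n + j)%N = adj G i j;
  rel_c : forall i j : 'I_n, adj G i j -> rmem s 0 (i * n + j)%N = c [set i; j]
}.

Record search_rel (s : state R) (Q : seq (seq 'I_n)) (hd w : nat)
    (bst : option (seq 'I_n)) : Prop := SearchRel {
  rel_input :> input_rel s;
  rel_hd : nmem s 7 0 = hd;
  rel_tl : nmem s 7 1 = size Q;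
  rel_w : nmem s 7 2 = w;
  rel_pw : nmem s 7 3 = (2 ^ w)%N;
  rel_queue : forall i, (i < size Q)%N -> nmem s 4 i = key z (nth [::] Q i);
  rel_seen : forall k, nmem s 6 k = (k \in keys Q);
  rel_code : forall p, p \in Q -> nmem s 5 (key z p) = pcode (z :: p);
  rel_dist : forall p, p \in Q -> rmem s 1 (key z p) = weight p;
  rel_best : if bst is Some b then
      [/\ nmem s 2 0 = 1%N, nmem s 7 4 = pcode (z :: b) &
          rmem s 2 0 = closed_weight c z b]
    else nmem s 2 0 = 0%N /\ nmem s 7 4 = 0%N;
  rel_bounded : bounded (n * n) s
}.

Lemma key_lt_bound p : simple p -> (key z p < 2 ^ (n * n))%N.
Proof. by move=> /andP [_ u]; apply: (queue_lt_bound n2); apply: ltnW; apply: key_lt. Qed.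

(** A crude bound that serves only to limit the bit length of the queue pointers; the running time
    rests on [size_keys]. *)
Lemma size_queue_le Q : all simple Q -> uniq (keys Q) -> (size Q <= 2 ^ n * n)%N.
Proof.
move=> sQ uQ; apply: leq_trans (size_keys sQ uQ) _; rewrite leq_mul2r.
apply/orP; right; apply: leq_trans (max_card _) _.
by rewrite -cardsT -powersetT card_powerset cardsT card_ord.
Qed.

Section Step.
Variables (s : state R) (Q : seq (seq 'I_n)) (hd w : nat) (bst : option (seq 'I_n)).
Hypotheses (inv : search_inv G c z Q hd w bst) (rel : search_rel s Q hd w bst).
Hypothesis hQ : (hd < size Q)%N.
Let p := nth [::] Q hd.

Lemma neval_eN : neval s eN = n. Proof. exact: rel_n rel. Qed.

Lemma neval_eCur : neval s eCur = key z p.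
Proof. by rewrite /= (rel_hd rel) (rel_queue rel). Qed.

Lemma neval_eX : neval s eX = mask (z :: p).
Proof. by rewrite -(key_div z p) -neval_eCur -neval_eN. Qed.

Lemma neval_eV : neval s eV = last z p.
Proof. by rewrite -(key_mod z p) -neval_eCur -neval_eN. Qed.

Lemma neval_eBack : neval s eBack = (last z p * n + z)%N.
Proof. by rewrite z0 addn0 -neval_eV -neval_eN. Qed.

Lemma pQ : p \in Q. Proof. exact: mem_nth. Qed.

Lemma simple_p : simple p.
Proof. by move/allP: (inv_simple inv); apply; exact: pQ. Qed.

Lemma uniq_p : uniq (z :: p). Proof. by have /andP [] := simple_p. Qed.

Lemma rmem_cur : rmem s 1 (neval s eCur) = weight p.
Proof. by rewrite neval_eCur (rel_dist rel) // pQ. Qed.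

Lemma beval_closing : w = n -> beval s closing = closes G z p.
Proof.
move=> wn; rewrite /closing /beval -/beval.
have -> : neval s (NBop Add eX (NCst 1)) = (mask (z :: p)).+1.
  by change (neval s eX + 1 = (mask (z :: p)).+1)%N; rewrite neval_eX addn1.
have -> : neval s (scal 3) = (2 ^ n)%N by rewrite -wn -(rel_pw rel).
have -> : neval s (NGet 1 eBack) = adj G (last z p) z.
  by rewrite -(rel_adj rel) -neval_eBack.
by rewrite mask_full ?uniq_p //= eqb1.
Qed.

Lemma run_improve : w = n -> closes G z p ->
  search_rel (run s set_if_better) Q hd w (improve c z bst p).
Proof.
move=> wn /andP [_ ap].
have tot : reval s eTot = closed_weight c z p.
  rewrite /closed_weight -(rel_c rel ap) -neval_eBack -rmem_cur //.
have setb : search_rel (run s set_best) Q hd w (Some p).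
  have -> : run s set_best = State
      (upd (upd (nmem s) 7 4 (nmem s 5 (neval s eCur))) 2 0 1%N)
      (upd (rmem s) 2 0 (reval s eTot)) by [].
  rewrite tot neval_eCur (rel_code rel pQ).
  case: (rel) => [[rn ra rc] rh rt rw rp rq rs rP rD rb rB].
  split => //.
  apply: (@bounded_upd _ _ _ _ _ (State (upd (nmem s) 7 4 _) (rmem s))).
    by apply: bounded_upd => //; apply: (pcode_lt_bound n2); exact: uniq_p.
  by apply: (small_lt_bound n2); lia.
have -> : run s set_if_better =
    if (nmem s 2 0 == 1%N) && (rmem s 2 0 <= reval s eTot) then s
    else run s set_best by [].
rewrite tot; have := rel_best rel; case: bst rel => [b|] rel' hb.
  case: hb => h1 h2 h3; rewrite h1 h3 eqxx andTb /improve.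
  by case: ifP.
by case: hb => -> _.
Qed.

Lemma run_advance bst' : search_rel s Q hd w bst' -> search_rel (run s advance) Q hd.+1 0 bst'.
Proof.
move=> rel'.
have -> : run s advance = State
    (upd (upd (upd (nmem s) 7 0 (nmem s 7 0 + 1)%N) 7 2 0%N) 7 3 1%N) (rmem s) by [].
case: rel' => [[rn ra rc] rh rt rw rp rq rs rP rD rb rB].
rewrite rh addn1; split => //.
pose st1 := State (upd (nmem s) 7 0 hd.+1) (rmem s).
pose st2 := State (upd (nmem st1) 7 2 0%N) (rmem s).
apply: (@bounded_upd _ _ _ _ _ st2); last by apply: (small_lt_bound n2); lia.
apply: (@bounded_upd _ _ _ _ _ st1); last by apply: (small_lt_bound n2); lia.
apply: bounded_upd => //; apply: (queue_lt_bound n2); apply: leq_trans hQ _.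
exact: size_queue_le (inv_simple inv) (inv_uniq inv).
Qed.


Variable u : 'I_n.
Hypothesis wu : w = u.
Let g := rcons p u.

Lemma neval_w : neval s (scal 2) = u. Proof. by rewrite -wu -(rel_w rel). Qed.

Lemma neval_pw : neval s (scal 3) = (2 ^ u)%N.
Proof. by rewrite -wu -(rel_pw rel). Qed.

Lemma neval_eIdx : neval s eIdx = (last z p * n + u)%N.
Proof.
have -> : neval s eIdx = (neval s eV * neval s eN + neval s (scal 2))%N by [].
by rewrite neval_eV neval_eN neval_w.
Qed.

Lemma neval_eKey : neval s eKey = key z g.
Proof.
have -> : neval s eKey =
  ((neval s eX + neval s (scal 3)) * neval s eN + neval s (scal 2))%N by [].
by rewrite neval_eX neval_pw neval_eN neval_w /g key_rcons.
Qed.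

Lemma beval_extendable : beval s extendable = simple g.
Proof.
have -> : beval s extendable = (nmem s 1 (neval s eIdx) == 1%N) &&
  ((neval s eX %/ neval s (scal 3)) %% 2 == 0)%N by [].
rewrite neval_eIdx neval_eX neval_pw (rel_adj rel) modn2 mask_bit ?uniq_p //.
by rewrite eqb1 eqb0 /g simple_path_rcons simple_p.
Qed.

Lemma reval_eNew : simple g -> reval s eNew = weight g.
Proof.
rewrite /g simple_path_rcons => /and3P [_ ap _].
by rewrite path_weight_rcons -(rel_c rel ap) -neval_eIdx -rmem_cur.
Qed.

Lemma run_set_path : simple g -> run s set_path =
  State (upd (nmem s) 5 (key z g) (pcode (z :: g))) (upd (rmem s) 1 (key z g) (weight g)).
Proof.
move=> sg.
have -> : run s set_path = State
  (upd (nmem s) 5 (neval s eKey) (nmem s 5 (neval s eCur) * neval s eN + neval s (scal 2)))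
  (upd (rmem s) 1 (neval s eKey) (reval s eNew)) by [].
rewrite neval_eKey reval_eNew // neval_eCur neval_eN neval_w (rel_code rel pQ).
by rewrite /g -rcons_cons pcode_rcons.
Qed.

Lemma bounded_set_path : simple g -> bounded (n * n) (run s set_path).
Proof.
move=> sg; rewrite run_set_path //; apply: bounded_upd; first exact: rel_bounded rel.
by apply: (pcode_lt_bound n2); have /andP [] := sg.
Qed.

Lemma run_push : simple g -> key z g \notin keys Q ->
  search_rel (run s (Seq set_path push)) (rcons Q g) hd w bst.
Proof.
move=> sg gQ; have hb := bounded_set_path sg.
have -> : run s (Seq set_path push) = run (run s set_path) push by [].
have -> : run (run s set_path) push =
    State (upd (upd (upd (nmem (run s set_path)) 6 (neval s eKey) 1%N)
                    4 (neval s (scal 1)) (neval s eKey))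
               7 1 (neval s (scal 1) + 1)%N)
          (rmem (run s set_path)) by [].
have tl : neval s (scal 1) = size Q by rewrite -(rel_tl rel).
rewrite neval_eKey tl addn1.
have szQ : (size Q < 2 ^ n * n)%N.
  have := @size_queue_le (rcons Q g); rewrite size_rcons; apply.
    by rewrite all_rcons sg (inv_simple inv).
  by rewrite map_rcons rcons_uniq gQ (inv_uniq inv).
have bnd : bounded (n * n) (State
    (upd (upd (upd (nmem (run s set_path)) 6 (key z g) 1%N) 4 (size Q) (key z g))
       7 1 (size Q).+1) (rmem (run s set_path))).
  pose st1 := State (upd (nmem (run s set_path)) 6 (key z g) 1%N) (rmem s).
  pose st2 := State (upd (nmem st1) 4 (size Q) (key z g)) (rmem s).
  apply: (@bounded_upd _ _ _ _ _ st2); last exact: (queue_lt_bound n2).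
  apply: (@bounded_upd _ _ _ _ _ st1); last exact: key_lt_bound.
  by apply: bounded_upd => //; apply: (small_lt_bound n2); lia.
move: bnd; rewrite run_set_path // /nmem /rmem -/(nmem s) -/(rmem s) => bnd.
have gp p' : p' \in Q -> (key z p' == key z g) = false.
  by move=> p'Q; apply: contraNF gQ => /eqP <-; apply: map_f.
case: (rel) => [[rn ra rc] rh rt rw rp rq rs rP rD rb rB].
split => //.
- by rewrite size_rcons.
- move=> i; rewrite size_rcons ltnS nth_rcons leq_eqVlt /upd /=.
  by case: eqP => [->|_] /= iQ; rewrite ?ltnn ?iQ ?rq.
- move=> k; rewrite map_rcons mem_rcons in_cons /upd /= rs.
  by case: eqP.
- move=> p'; rewrite mem_rcons in_cons /upd /= => /orP [/eqP ->|p'Q].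
    by rewrite eqxx.
  by rewrite gp ?rP.
- move=> p'; rewrite mem_rcons in_cons /upd /= => /orP [/eqP ->|p'Q].
    by rewrite eqxx.
  by rewrite gp ?rD.
Qed.

Lemma run_extend : simple g -> search_rel (run s extend) (enqueue c z Q g) hd w bst.
Proof.
move=> sg.
have -> : run s extend =
    if nmem s 6 (neval s eKey) == 0%N then run s (Seq set_path push)
    else if rmem s 1 (neval s eKey) <= reval s eNew then s else run s set_path by [].
rewrite neval_eKey reval_eNew // (rel_seen rel) eqb0.
case: ifP => gQ; first by rewrite /enqueue (negbTE gQ); apply: run_push.
move/negbFE: (gQ) => {}gQ.
have dist p' : p' \in Q -> key z p' = key z g -> rmem s 1 (key z g) = weight p'.
  by move=> p'Q <-; rewrite (rel_dist rel).
have szE : size (enqueue c z Q g) = size Q by rewrite /enqueue gQ size_map.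
have keysE : keys (enqueue c z Q g) = keys Q by rewrite keys_enqueue gQ.
have qE i : (i < size Q)%N ->
    key z (nth [::] (enqueue c z Q g) i) = key z (nth [::] Q i).
  by move=> iQ; rewrite nth_enqueue //; case: ifP => // /andP [/eqP ->].
case: ifP => [wg|wg].
  rewrite (_ : enqueue c z Q g = Q) // /enqueue gQ -[RHS]map_id.
  apply/eq_in_map => p' p'Q; case: eqP => //= k; move: wg; rewrite (dist p') // leNgt.
  by case: ifP.
have := bounded_set_path sg; rewrite run_set_path // => bnd.
(* The stored distance exceeds the weight of [g], so the entry with this key has been replaced by
   [g]; all other entries have different keys, and the overwritten cells do not concern them. *)
have memE p' : p' \in enqueue c z Q g -> p' = g \/ p' \in Q /\ key z p' != key z g.
  rewrite /enqueue gQ => /mapP [p'' p''Q ->]; case: ifP => h; first by left.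
  right; split => //; apply/negP => /eqP k; move: h wg.
  by rewrite k eqxx /= (dist p'') // leNgt => ->.
case: (rel) => [[rn ra rc] rh rt rw rp rq rs rP rD rb rB].
split => //.
- by rewrite szE.
- by move=> i; rewrite szE => iQ; rewrite qE // -rq.
- by move=> k; rewrite keysE -rs.
- by move=> p' /memE [->|[p'Q kn]]; rewrite /upd /= ?eqxx // (negbTE kn) rP.
- by move=> p' /memE [->|[p'Q kn]]; rewrite /upd /= ?eqxx // (negbTE kn) rD.
Qed.

End Step.
End Refinement.

(** * Initial state, search loop and decoding loop *)

Lemma table_entry (T : Type) (x0 : T) (n : nat) (f : 'I_n -> 'I_n -> T)
    (i j : 'I_n) : table x0 f (i * n + j)%N = f i j.
Proof.
have n0 : (0 < n)%N by apply: leq_trans (ltn_ord i).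
rewrite /table divnMDl // divn_small // addn0 modnMDl modn_small //.
by rewrite !valK.
Qed.

Lemma bounded_input (R : realType) (n : nat) (G : sgraph n) (c : {set 'I_n} -> R) B :
  (n < 2 ^ B)%N -> (0 < B)%N -> bounded B (input G c).
Proof.
move=> nB B0; have B1 : (1 < 2 ^ B)%N by rewrite -[1%N](expn0 2) ltn_exp2l.
move=> [|[|a]] k /=; last by rewrite expn_gt0.
  by case: ifP => _ //; rewrite expn_gt0.
rewrite /table; case: insub => [i|]; last by rewrite expn_gt0.
case: insub => [j|]; last by rewrite expn_gt0.
by apply: leq_ltn_trans (leq_b1 _) B1.
Qed.

Section SearchLoop.
Variables (R : realType) (n : nat) (G : sgraph n) (c : {set 'I_n} -> R).
Variables (z : 'I_n).
Hypotheses (z0 : nat_of_ord z = 0%N) (n2 : (2 < n)%N).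

Notation simple := (simple_path G z).

Lemma run_tick s Q hd w bst : search_rel G c z s Q hd w bst -> (w < n)%N ->
  search_rel G c z (run s tick) Q hd w.+1 bst.
Proof.
move=> rel wn.
have -> : run s tick = State
    (upd (upd (nmem s) 7 2 (nmem s 7 2 + 1)%N) 7 3 (nmem s 7 3 * 2)%N) (rmem s) by [].
case: rel => [[rn ra rc] rh rt rw rp rq rs rP rD rb rB].
rewrite rw rp addn1 mulnC -expnS; split => //.
pose st1 := State (upd (nmem s) 7 2 w.+1) (rmem s).
apply: (@bounded_upd _ _ _ _ _ st1); last exact: (pow2_lt_bound n2).
by apply: bounded_upd => //; apply: (small_lt_bound n2).
Qed.

Lemma run_body s Q hd w bst : search_inv G c z Q hd w bst ->
  search_rel G c z s Q hd w bst -> (hd < size Q)%N ->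
  exists Q' hd' w' bst', [/\ search_inv G c z Q' hd' w' bst',
    search_rel G c z (run s body) Q' hd' w' bst' &
    [/\ hd' = hd, w' = w.+1 & (w < n)%N] \/ [/\ hd' = hd.+1, w' = 0%N & w = n]].
Proof.
move=> inv rel hQ.
have -> : run s body = if (nmem s 7 2 + 1 <= nmem s 0 0)%N
    then run (if beval s extendable then run s extend else s) tick
    else run (if beval s closing then run s set_if_better else s) advance by [].
rewrite (rel_w rel) (rel_n rel) addn1; case: ltnP => wn; last first.
  have {wn} wn : w = n by apply/eqP; rewrite eqn_leq wn (inv_w inv).
  rewrite (beval_closing z0 inv rel hQ wn).
  set bst' := if closes G z (nth [::] Q hd) then improve c z bst (nth [::] Q hd) else bst.
  exists Q, hd.+1, 0%N, bst'; split; last by right.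
    by rewrite wn in inv; apply: search_next.
  rewrite /bst'; case: ifP => cl; apply: (run_advance z0 n2 inv hQ) => //.
  exact: (run_improve z0 n2 inv rel hQ wn cl).
pose u := Ordinal wn; have wu : w = u by [].
rewrite (beval_extendable inv rel hQ wu).
case: ifP => sg.
  exists (enqueue c z Q (rcons (nth [::] Q hd) u)), hd, w.+1, bst; split.
  - by rewrite wu; apply: search_extend.
  - by apply: run_tick => //; exact: (run_extend z0 n2 inv rel hQ wu sg).
  - by left.
exists Q, hd, w.+1, bst; split; last by left.
  exact: (search_skip (u := u) inv (negbT sg)).
exact: run_tick.
Qed.

Lemma run_init : search_rel G c z (run (input G c) init) [:: [::]] 0 0 None.
Proof.
have -> : run (input G c) init = State
    (upd (upd (upd (upd (nmem (input G c)) 4 0 n) 6 n 1%N) 7 1 1%N) 7 3 1%N)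
    (rmem (input G c)) by [].
(* Since [z] is vertex 0, the root state has mask 1 and end 0, hence key [n], and its path code and
   distance are 0. So [init] queues and marks [n], and leaves array 5 and real array 1 at their
   initial zeros. *)
have kn : key z [::] = n by rewrite /key /mask big_seq1 /= z0 mul1n addn0.
have pz : pcode [:: z] = 0%N by rewrite /pcode /= z0.
split => //.
- split => // [i j|i j aij]; first by rewrite -(table_entry 0%N (fun i j => nat_of_bool (adj G i j))).
  by rewrite /= table_entry aij.
- by move=> [|i] //; rewrite /= kn.
- by move=> k; rewrite /upd /= kn inE; case: eqP.
- by move=> p; rewrite inE => /eqP ->; rewrite pz.
- by move=> p; rewrite inE => /eqP ->; rewrite /path_weight big_geq.
set st0 := input G c.
pose st1 := State (upd (nmem st0) 4 0 n) (rmem st0).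
pose st2 := State (upd (nmem st1) 6 n 1%N) (rmem st0).
pose st3 := State (upd (nmem st2) 7 1 1%N) (rmem st0).
have n1 : (1 <= n)%N by lia.
apply: (@bounded_upd _ _ _ _ _ st3); last exact: (small_lt_bound n2).
apply: (@bounded_upd _ _ _ _ _ st2); last exact: (small_lt_bound n2).
apply: (@bounded_upd _ _ _ _ _ st1); last exact: (small_lt_bound n2).
apply: bounded_upd; last exact: (small_lt_bound n2).
by apply: bounded_input; [exact: (small_lt_bound n2)|rewrite muln_gt0 n1].
Qed.

Definition search_state (s : state R) := exists Q hd w bst,
  search_inv G c z Q hd w bst /\ search_rel G c z s Q hd w bst.

(** Lexicographic in the head and the next vertex, each head being worth [n.+1] rounds. The limit
    for the head is the number of possible states and not the length of the queue, which grows
    during the run. *)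
Definition search_measure (s : state R) :=
  ((#|reachable_sets G z| * n - nmem s 7 0) * n.+1 + (n - nmem s 7 2))%N.

Lemma search_state_step s : search_state s -> beval s pending ->
  search_state (run s body) /\ (search_measure (run s body) < search_measure s)%N.
Proof.
move=> [Q [hd [w [bst [inv rel]]]]].
have -> : beval s pending = (nmem s 7 0 + 1 <= nmem s 7 1)%N by [].
rewrite (rel_hd rel) (rel_tl rel) addn1 => hQ.
have [Q' [hd' [w' [bst' [inv' rel' e]]]]] := run_body inv rel hQ.
split; first by exists Q', hd', w', bst'.
rewrite /search_measure (rel_hd rel) (rel_w rel) (rel_hd rel') (rel_w rel').
have hN : (hd < #|reachable_sets G z| * n)%N.
  exact: leq_trans hQ (size_keys (inv_simple inv) (inv_uniq inv)).
move: (_ * n)%N hN => N hN.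
case: e => [[-> -> wn]|[-> -> ->]]; first by lia.
rewrite subn0 subnn addn0.
have -> : (N - hd = (N - hd.+1).+1)%N by lia.
by rewrite mulSn; lia.
Qed.

Record decode_rel (f : nat) (h : seq 'I_n) (s : state R) : Prop := DecodeRel {
  dec_n : nmem s 0 0 = n;
  dec_found : nmem s 2 0 = f;
  dec_le : (nmem s 7 5 <= n)%N;
  dec_code : nmem s 7 4 = pcode (take (nmem s 7 5) h);
  dec_out : forall j, (nmem s 7 5 <= j < n)%N -> nmem s 3 j = nth z h j;
  dec_bounded : bounded (n * n) s
}.

(** The last digit of the code is the last vertex not yet written, so the output array is filled
    from the end. *)
Lemma decode_step f h s : size h = n -> decode_rel f h s -> beval s undecoded ->
  decode_rel f h (run s decode_body) /\
  (nmem (run s decode_body) 7 5 < nmem s 7 5)%N.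
Proof.
move=> sh [rn rf le rc ro rB].
have -> : beval s undecoded = (0 < nmem s 7 5)%N by [].
have -> : run s decode_body = State
  (upd (upd (upd (nmem s) 7 5 (nmem s 7 5 - 1)%N)
    3 (nmem s 7 5 - 1)%N (nmem s 7 4 %% nmem s 0 0)%N)
    7 4 (nmem s 7 4 %/ nmem s 0 0)%N) (rmem s) by [].
rewrite rn rc; case e: (nmem s 7 5) le rc ro => [|i] // le rc ro _.
rewrite subn1 /=.
have n0 : (0 < n)%N by lia.
have -> : pcode (take i.+1 h) = (pcode (take i h) * n + nth z h i)%N.
  by rewrite (take_nth z) ?sh // pcode_rcons.
rewrite divnMDl // divn_small // addn0 modnMDl modn_small //.
split; last by rewrite /upd /=.
split => //; try by rewrite /upd /=; lia.
- move=> j; rewrite /upd /=; have [->|ne] := eqVneq j i; first by [].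
  by move=> ij; apply: ro; lia.
pose st1 := State (upd (nmem s) 7 5 i) (rmem s).
pose st2 := State (upd (nmem st1) 3 i (nth z h i : nat)) (rmem s).
apply: (@bounded_upd _ _ _ _ _ st2); last first.
  apply: leq_ltn_trans (rB 7 4); rewrite rc (take_nth z) ?sh // pcode_rcons.
  by apply: leq_trans (leq_addr _ _); rewrite leq_pmulr.
apply: (@bounded_upd _ _ _ _ _ st1).
  by apply: bounded_upd => //; apply: (small_lt_bound n2); lia.
by apply: (small_lt_bound n2) => //; apply: ltnW.
Qed.

(** Decoding runs even when no cycle was found. The best code is then still 0, which reads as [n]
    copies of vertex 0, and the output flag makes this list irrelevant. *)
Lemma start_decode_rel s Q hd w bst : search_inv G c z Q hd w bst ->
  search_rel G c z s Q hd w bst ->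
  decode_rel (bst != None) (if bst is Some b then z :: b else nseq n z)
    (run s start_decode).
Proof.
move=> inv rel.
have -> : run s start_decode = State (upd (nmem s) 7 5 (nmem s 0 0)) (rmem s) by [].
rewrite (rel_n rel).
have rb := rel_best rel; have ib := inv_bst inv.
split; rewrite /upd /=.
- exact: rel_n rel.
- by case: bst rb {rel ib inv} => [b [] | []].
- exact: leqnn.
- case: bst rb ib {rel inv} => [b [_ -> _] ib|[_ ->] _].
    have [_ /andP [/eqP sb _]] := ib _ erefl.
    by rewrite take_oversize //= sb.
  rewrite take_oversize ?size_nseq //.
  have zeros k : pcode (nseq k z) = 0%N by elim: k => // k; rewrite /pcode /= z0.
  by rewrite zeros.
- by move=> j; lia.
by apply: bounded_upd; [exact: rel_bounded rel|exact: (small_lt_bound n2)].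
Qed.

End SearchLoop.

(** * From the final state to the answer and the running time *)

Lemma cycle_weight_rot (R : realType) (n : nat) (c : {set 'I_n} -> R)
    (i : nat) (h : seq 'I_n) : uniq h ->
  cycle_weight c (rot i h) = cycle_weight c h.
Proof.
move=> uh; rewrite /cycle_weight (perm_big _ (permEl (perm_rot i h))) /=.
by apply: eq_bigr => x _; rewrite next_rot.
Qed.

Lemma ham_cycle_cons (n : nat) (G : sgraph n) (z : 'I_n) (p : seq 'I_n) :
  (2 < n)%N -> ham_cycle G (z :: p) = simple_path G z p && closes G z p.
Proof.
move=> n2; rewrite /ham_cycle n2 /ucycleb /simple_path /closes /= rcons_path.
by case: (_ == n); case: path; case: adj; rewrite ?andbF ?andbT.
Qed.

(** Searching from the single root [z] loses nothing: a Hamiltonian cycle passes through [z], and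
    rotating it changes neither its edges nor its weight. *)
Lemma ham_cycle_from (R : realType) (n : nat) (G : sgraph n) (c : {set 'I_n} -> R)
    (z : 'I_n) (h : seq 'I_n) : ham_cycle G h ->
  exists p, [/\ simple_path G z p, closes G z p &
    cycle_weight c h = closed_weight c z p].
Proof.
move=> hh; have /and3P [n2 /eqP sh /andP [ch uh]] := hh.
have zh : z \in h.
  have [_ ->] := uniq_min_size uh (s2 := enum 'I_n) (fun x _ => mem_enum 'I_n x)
    (eq_leq (etrans (size_enum_ord n) (esym sh))); exact: mem_enum.
have [i p ep] := rot_to zh; exists p.
have : ham_cycle G (rot i h).
  by rewrite /ham_cycle n2 size_rot sh eqxx /ucycleb rot_cycle rot_uniq ch uh.
rewrite ep ham_cycle_cons // => /andP [sp cp]; split => //.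
have /andP [_ up] := sp.
by rewrite -(cycle_weight_rot c i uh) ep cycle_weight_cons.
Qed.

Lemma decoded_answer (R : realType) (n : nat) (G : sgraph n) (c : {set 'I_n} -> R)
    (z : 'I_n) Q w bst (s : state R) : (2 < n)%N ->
  search_inv G c z Q (size Q) w bst ->
  decode_rel z (bst != None) (if bst is Some b then z :: b else nseq n z) s ->
  nmem s 7 5 = 0%N -> tsp_answer G c (output n s).
Proof.
move=> n2 inv [rn rf _ _ ro _] r0; rewrite /output rf.
case: bst inv rf ro => [b|] inv _ ro /=; last first.
  move=> h; apply/negP => /(ham_cycle_from c z) [p [sp cp _]].
  by have [] := search_optimal inv sp cp.
have [sb cb] := inv_bst inv erefl; have /andP [/eqP size_b _] := cb.
exists (z :: b); split.
- apply: (@eq_from_nth _ 0%N); first by rewrite size_mkseq size_map.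
  move=> i; rewrite size_mkseq => hi.
  by rewrite nth_mkseq // ro ?r0 // (nth_map z) //= size_b.
- by rewrite ham_cycle_cons // sb.
move=> h /(ham_cycle_from c z) [p [sp cp ->]].
have [_ [<-]] := search_optimal inv sp cp.
by have /andP [_ ub] := sb; rewrite cycle_weight_cons.
Qed.

(** [F] isolates the only factor that can be exponential. The alternative [F = 0] covers the early
    exit, where for [n = 0] there is not even a root. *)
Lemma tsp_program_spec : exists K : nat,
  forall (R : realType) (n : nat) (G : sgraph n) (c : {set 'I_n} -> R),
  exists (s : state R) (t : nat) (F : nat),
    [/\ exec tsp_program (input G c) s t, tsp_answer G c (output n s),
        (t <= K * n.+1 ^ 4 * F.+1)%N &
        F = 0%N \/ exists z : 'I_n, F = #|reachable_sets G z|].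
Proof.
have [K0 h0] := bcost_bound (NLe eN (NCst 2)).
have [K1 _ h1] := @loop_free_exec init isT.
have [K2 h2] := @while_exec pending body isT.
have [K3 _ h3] := @loop_free_exec start_decode isT.
have [K4 h4] := @while_exec undecoded decode_body isT.
exists (K0 + 1 + K1 + K2 + K3 + K4)%N => R n G c.
have hc : (bcost (input G c) (NLe eN (NCst 2)) <= K0 * n.+1)%N.
  apply: h0 => //; apply: bounded_input => //; exact: ltnW (ltn_expl _ _).
have [n2|n2] := leqP n 2.
  exists (input G c), (bcost (input G c) (NLe eN (NCst 2)) + 1)%N, 0%N.
  split; [| |nia|by left].
    by apply: exec_if_true => //; exact: exec_skip.
  by move=> h; rewrite /ham_cycle ltnNge n2.
have n0 : (0 < n)%N by lia.
pose z := Ordinal n0; have z0 : nat_of_ord z = 0%N by [].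
have B0 : (0 < n * n)%N by rewrite muln_gt0 n0.
have [|t1 e1 [ht1 _]] := h1 R (input G c) (n * n)%N B0.
  by apply: bounded_input => //; exact: small_lt_bound.
have [||s2 [t2 [e2 [Q [hd [w [bst [inv rel]]]]] np ht2]]] :=
  h2 R (n * n)%N (search_state G c z) (search_measure G z) B0 _
    (search_state_step z0 n2) (run (input G c) init).
- by move=> s [Q [hd [w [bst [_ rel]]]]]; exact: rel_bounded rel.
- exists [:: [::]], 0%N, 0%N, None; split; first exact: search_inv0.
  exact: run_init.
have [t3 e3 [ht3 _]] := h3 R s2 (n * n)%N B0 (rel_bounded rel).
have hdE : hd = size Q.
  apply/eqP; rewrite eqn_leq (inv_hd inv) /=.
  move: np; rewrite (_ : beval s2 pending = (nmem s2 7 0 + 1 <= nmem s2 7 1)%N) //.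
  by rewrite (rel_hd rel) (rel_tl rel) addn1 -leqNgt.
rewrite hdE in inv rel.
set h := if bst is Some b then z :: b else nseq n z.
have sh : size h = n.
  rewrite /h; case: (bst) inv => [b|] inv; last by rewrite size_nseq.
  by have [_ /andP [/eqP]] := inv_bst inv erefl.
have [||s4 [t4 [e4 rel4 nd ht4]]] :=
  h4 R (n * n)%N (decode_rel z (bst != None) h) (fun s => nmem s 7 5) B0 _
    (fun s => decode_step z0 n2 sh (s := s)) (run s2 start_decode).
- by move=> s; case.
- exact: (start_decode_rel z0 n2 inv rel).
have z4 : nmem s4 7 5 = 0%N by move: nd; rewrite /= -ltnNge ltnS leqn0 => /eqP.
exists s4, (bcost (input G c) (NLe eN (NCst 2)) + (t1 + (t2 + (t3 + t4))))%N.
exists #|reachable_sets G z|; split.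
- apply: exec_if_false; first by rewrite /= -ltnNge.
  by apply: exec_seq e1 _; apply: exec_seq e2 _; apply: exec_seq e3 e4.
- exact: (decoded_answer n2 inv rel4 z4).
- have mu : (search_measure G z (run (input G c) init) <= #|reachable_sets G z| * n * n.+1 + n)%N.
    by rewrite /search_measure /= leq_add ?leq_subr // leq_mul2r leq_subr orbT.
  have nE : nmem (run s2 start_decode) 7 5 = n by rewrite /= (rel_n rel).
  rewrite nE in ht4.
  move: (#|reachable_sets G z|) mu ht2 => F; move: (search_measure _ _ _) => m mu ht2.
  (* The fourth power: each round costs about [n * n], the bit length of the cells, and each
     reachable set accounts for up to [n] states of [n.+1] rounds. *)
  set P := (n.+1 ^ 4 * F.+1)%N.
  have PE : P = (n.+1 * n.+1 * (n.+1 * n.+1) * F.+1)%N by rewrite /P !expnS expn0 muln1 !mulnA.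
  have a4 : (n * n * n.+1 <= P)%N by rewrite PE; nia.
  have a1 : (n.+1 <= P)%N by apply: leq_trans a4; nia.
  have a2 : (n * n <= P)%N by apply: leq_trans a4; nia.
  have a3 : (n * n * m.+1 <= P)%N.
    apply: (@leq_trans (n * n * (F * n * n.+1 + n.+1))%N).
      by rewrite leq_mul2l; apply/orP; right; lia.
    rewrite (_ : F * n * n.+1 + n.+1 = n.+1 * (F * n + 1))%N; last by lia.
    rewrite (_ : P = n.+1 * n.+1 * (n.+1 * (n.+1 * F.+1)))%N; last by rewrite PE; lia.
    by apply: leq_mul; [apply: leq_mul|apply: leq_mul => //; nia].
  rewrite -(mulnA _ (_ ^ _)%N) -/P.
  have b0 := leq_mul (leqnn K0) a1; have b1 := leq_mul (leqnn K1) a2.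
  have b2 := leq_mul (leqnn K2) a3; have b3 := leq_mul (leqnn K3) a2.
  have b4 := leq_mul (leqnn K4) a4.
  have P0 : (0 < P)%N by apply: leq_trans a1.
  move: hc ht1 ht2 ht3 ht4 b0 b1 b2 b3 b4.
  by rewrite -!(mulnA K2) -!(mulnA K4); lia.
by right; exists z.
Qed.

(** * From the counting bound to a real exponent *)

(** With [y] the power on the right, [y ^ W * 2 ^ n = 2 ^ (W * n)], so strict monotonicity of the
    [W]-th power extracts the root. The [n.+1] in the hypothesis becomes the factor 2. *)
Lemma root_bound (R : realType) (W n F : nat) : (0 < W)%N ->
  (F ^ W * 2 ^ n <= 2 ^ (W * n.+1))%N ->
  F%:R <= 2 * 2 `^ ((1 - W%:R^-1) * n%:R) :> R.
Proof.
move=> W0 hF; set y := _ `^ _.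
have y0 : 0 <= y by exact: powR_ge0.
have Wn0 : W%:R != 0 :> R by rewrite pnatr_eq0 -lt0n.
have yW : y ^+ W * 2 ^+ n = 2 ^+ (W * n).
  rewrite -!powR_mulrn // /y -powRrM -powRD; last by apply/implyP; rewrite pnatr_eq0.
  by congr (_ `^ _); rewrite natrM; field.
rewrite leNgt; apply/negP => hlt.
have : (2 * y) ^+ W * 2 ^+ n < F%:R ^+ W * 2 ^+ n :> R.
  by rewrite ltr_pM2r ?exprn_gt0 // ltr_pXn2r // nnegrE ?mulr_ge0.
rewrite exprMn -mulrA yW -exprD -mulnS -!natrX -natrM ltr_nat.
by rewrite ltnNge hF.
Qed.

Lemma powR_exponent_ge1 (R : realType) (W n : nat) : (0 < W)%N ->
  1 <= 2 `^ ((1 - W%:R^-1) * n%:R) :> R.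
Proof.
move=> W0; rewrite -[leLHS](powRr0 2) ler_powR ?ler1n // mulr_ge0 //.
by rewrite subr_ge0 invf_le1 ?ler1n ?ltr0n.
Qed.

Lemma avg_degree_le (R : realType) (n d : nat) (G : sgraph n) : (0 < n)%N ->
  avg_degree R G <= d%:R -> (\sum_v deg G v <= d * n)%N.
Proof.
move=> n0; rewrite /avg_degree ler_pdivrMr ?ltr0n //.
by rewrite -natrM ler_nat.
Qed.

Theorem theorem1p1 (R : realType) (d : R) (hd : 1 <= d) :
  exists2 eps : R, 0 < eps &
  exists (p : cmd) (C k : nat),
  forall (n : nat) (G : sgraph n) (c : {set 'I_n} -> R),
    avg_degree R G <= d ->
    (forall e : {set 'I_n}, e \in edges G -> 0 <= c e) ->
    exists (s : state R) (t : nat),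
      [/\ exec p (input G c) s t,
          tsp_answer G c (output n s) &
          t%:R <= C%:R * (n + #|edges G|).+1%:R ^+ k
                  * 2 `^ ((1 - eps) * n%:R)].
Proof.
(* The real bound is rounded up to a natural number, since the counting argument is carried out in
   integers. *)
have [d' dd'] : exists d' : nat, d <= d'%:R.
  by exists (Num.bound d); apply/ltW/archi_boundP; apply: le_trans hd.
have [W W0 hW] := reachable_sets_bound d'.
have [K hK] := tsp_program_spec.
exists W%:R^-1; first by rewrite invr_gt0 ltr0n.
exists tsp_program, (3 * K)%N, 4%N => n G c hdeg _.
have [s [t [F [ex ans ht hF]]]] := hK R n G c.
exists s, t; split => //.
set y := 2 `^ _; have y1 : 1 <= y by exact: powR_exponent_ge1.
have Fy : F%:R <= 2 * y.
  case: hF => [->|[z ->]]; first by apply: mulr_ge0 => //; exact: le_trans y1.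
  apply: root_bound => //; apply: (hW n G z).
    apply: (@avg_degree_le R); last exact: le_trans dd'.
    exact: leq_ltn_trans (ltn_ord z).
  by move=> X; rewrite inE => /asboolP.
(* The factor 3 is the 2 from [root_bound] plus 1 for the successor, absorbed by [1 <= y]. *)
have F1y : F.+1%:R <= 3 * y by rewrite -natr1; lra.
apply: (@le_trans _ _ ((K * n.+1 ^ 4 * F.+1)%N%:R)); first by rewrite ler_nat.
rewrite natrM [(K * _)%:R]natrM natrX natrM; set a := K%:R.
have a0 : 0 <= a by exact: ler0n.
apply: (@le_trans _ _ (a * (n + #|edges G|).+1%:R ^+ 4 * (3 * y))); last by lra.
apply: ler_pM => //; first by rewrite mulr_ge0 // exprn_ge0.
by rewrite ler_wpM2l // lerXn2r ?nnegrE // ler_nat ltnS leq_addr.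
Qed.
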